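(* Let $(V,m,\sigma)$ be a finite dimensional Yang-Baxter algebra with linear basis $(e_1,\ldots,e_N)$ whose braiding has the form $\sigma(e_i\otimes e_j)=q_{ij}\,e_j\otimes e_i$ for all $i,j$, where the $q_{ij}$ are powers of a fixed nonzero scalar $q\in K$ and $q$ is not a root of unity. Let $L$ be the set of Lyndon words of $T^+(V)$ with respect to the order $e_1<e_2<\cdots<e_N$. Then the set $$\{l_1\Join_\sigma\cdots\Join_\sigma l_r\mid r\geq 1,\ l_i\in L,\ l_1\ge\cdots\ge l_r\}$$ forms a $K$-linear basis of $T^+(V)$.
   Context: $K$ is a ground field of characteristic $0$; all objects are over $K$; algebras are associative and unital. A braiding on a vector space $V$ is an invertible $\sigma\in\mathrm{End}(V\otimes V)$ with $(\sigma\otimes \mathrm{id}_V)(\mathrm{id}_V\otimes\sigma)(\sigma\otimes \mathrm{id}_V)=(\mathrm{id}_V\otimes\sigma)(\sigma\otimes \mathrm{id}_V)(\mathrm{id}_V\otimes\sigma)$ on $V^{\otimes 3}$. On $V^{\otimes n}$ put $\sigma_i=\mathrm{id}_V^{\otimes(i-1)}\otimes\sigma\otimes\mathrm{id}_V^{\otimes(n-i-1)}$. Operators compose from right to left. For $w\in\mathfrak S_n$ with reduced expression $w=s_{i_1}\cdots s_{i_l}$, $s_i=(i,i+1)$, put $T^\sigma_w=\sigma_{i_1}\cdots\sigma_{i_l}$ (well defined). Yang-Baxter (YB) algebra: $(A,m,\sigma)$ with $(A,m)$ an algebra with unit $1_A$ and $\sigma$ a braiding on $A$ such that $(\mathrm{id}_A\otimes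 m)\sigma_1\sigma_2=\sigma(m\otimes\mathrm{id}_A)$, $(m\otimes\mathrm{id}_A)\sigma_2\sigma_1=\sigma(\mathrm{id}_A\otimes m)$, and $\sigma(1_A\otimes a)=a\otimes 1_A$, $\sigma(a\otimes 1_A)=1_A\otimes a$ for all $a\in A$. $T(V)=\bigoplus_{n\ge0}V^{\otimes n}$, $V^{\otimes0}=K$; $\underline{\otimes}$ denotes the tensor product between copies of $T(V)$. For $i,j\ge1$ let $\chi_{ij}\in\mathfrak S_{i+j}$, $\chi_{ij}(k)=j+k$ for $1\le k\le i$ and $\chi_{ij}(i+k)=k$ for $1\le k\le j$. The braiding $\beta$ on $T(V)$ is $\beta_{ij}=T^\sigma_{\chi_{ij}}$ on $V^{\otimes i}\underline{\otimes}V^{\otimes j}$ ($i,j\ge1$), with $\beta_{0i},\beta_{i0}$ the usual flips. $T^c(V)=(T(V),\delta,\varepsilon)$, where $\delta(v_1\otimes\cdots\otimes v_n)=\sum_{i=0}^n(v_1\otimes\cdots\otimes v_i)\underline{\otimes}(v_{i+1}\otimes\cdots\otimes v_n)$ and $\varepsilon$ is the projection $T(V)\to K$. Define $M_{pq}\colon V^{\otimes p}\underline{\otimes}V^{\otimes q}\to V$ by $M_{00}=0$, $M_{10}=\mathrm{id}_V=M_{01}$, $M_{11}=m$, $M_{pq}=0$ otherwise, and $M=(M_{pq})\colon T^c(V)\underline{\otimes}T^c(V)\to V$. Put $\bigtriangleup_\beta=(\mathrm{id}\otimes\beta\otimes\mathrm{id})(\delta\otimes\delta)$, $\bigtriangleup_\beta^{(0)}=\mathrm{id}$,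 $\bigtriangleup_\beta^{(n)}=(\bigtriangleup_\beta\otimes\mathrm{id}_{T^c(V)}^{\otimes 2(n-1)})\circ\bigtriangleup_\beta^{(n-1)}$. The quantum quasi-shuffle product is $\Join_\sigma=\varepsilon\otimes\varepsilon+\sum_{n\ge1}M^{\otimes n}\circ\bigtriangleup_\beta^{(n-1)}\colon T^c(V)\underline{\otimes}T^c(V)\to T^c(V)$ (finite sum on each element); it is associative on $T^c(V)$ when $(V,m,\sigma)$ is a YB algebra. $T^+(V)=T(V)/K$, identified with $\bigoplus_{n\ge1}V^{\otimes n}$, has the $K$-basis $\mathrm{(I)}=\{e_{i_1}\otimes\cdots\otimes e_{i_m}\mid m>0,\ 1\le i_1,\ldots,i_m\le N\}$. The set (I) is totally ordered by the lexicographic order induced by $e_1<e_2<\cdots<e_N$, with the convention that $a\le a\otimes b$. An element $p$ of (I) is a Lyndon word if for every splitting $p=a\otimes b$ with $a,b\in\mathrm{(I)}$ one has $p<b$. *)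

(* Defs.v *)
(* Every space is a free K-module {malg K[A]} on a set A of basis labels, and
   the tensor product of {malg K[A]} and {malg K[B]} is {malg K[A * B]}.  For a
   space V with basis e = (e_0, ..., e_(N-1)):
     {malg K['I_N]}          is V, through the coordinates in e;
     {malg K['I_N * 'I_N]}   is the tensor square of V;
     {malg K[seq 'I_N]}      is T(V): the word [:: i1; ...; in] stands for
                             e_i1 (x) ... (x) e_in, and the words of size n
                             span the n-th tensor power of V;
     {malg K[seq 'I_N * seq 'I_N]}  is T(V) (x) T(V).
   The maps crd, tens2 and tens give the pure tensors of arbitrary vectors. *)

From HB Require Import structures.
From mathcomp Require Import all_boot all_order all_algebra all_fingroup.
From mathcomp Require Import finmap sesquilinear.
From mathcomp Require Export monalg.

Set Implicit Arguments.
Unset Strict Implicit.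
Unset Printing Implicit Defensive.

Import Order.TTheory GRing.Theory.
Local Open Scope ring_scope.

Notation Tsq K N := {malg K[('I_N * 'I_N)%type]}.
Notation Talg K N := {malg K[seq 'I_N]}.

Section LinearExtension.
Variable K : fieldType.
Implicit Types A B C D : choiceType.

Definition lext A (M : lmodType K) (f : A -> M) (x : {malg K[A]}) : M :=
  \sum_(a <- msupp x) x@_a *: f a.

Definition tmul A B (x : {malg K[A]}) (y : {malg K[B]}) : {malg K[(A * B)%type]} :=
  lext (fun a => lext (fun b => << (a, b) >>) y) x.

Lemma lextw A (M : lmodType K) (f : A -> M) (x : {malg K[A]}) (d : {fset A}) :
  (msupp x `<=` d)%fset -> lext f x = \sum_(a <- d) x@_a *: f a.
Proof.
move=> le; rewrite /lext; apply: (big_fset_incl _ le) => a _ /mcoeff_outdom ->.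
by rewrite scale0r.
Qed.

Lemma lext_is_linear A (M : lmodType K) (f : A -> M) : linear (lext f).
Proof.
move=> c x y; pose d := (msupp (c *: x + y) `|` (msupp x `|` msupp y))%fset.
have hxy : (msupp (c *: x + y) `<=` d)%fset by rewrite fsubsetUl.
have hx : (msupp x `<=` d)%fset by rewrite /d fsetUCA fsubsetUl.
have hy : (msupp y `<=` d)%fset by rewrite /d fsetUA fsubsetUr.
rewrite (lextw f hxy) (lextw f hx) (lextw f hy) scaler_sumr -big_split /=.
by apply: eq_bigr => a _; rewrite mcoeffD mcoeffZ scalerDl scalerA.
Qed.

HB.instance Definition _ A (M : lmodType K) (f : A -> M) :=
  GRing.isLinear.Build K {malg K[A]} M *:%R (lext f) (lext_is_linear f).

Lemma lextU A (M : lmodType K) (f : A -> M) a : lext f << a >> = f a.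
Proof.
by rewrite (lextw f msuppU_le) big_seq_fset1 mcoeffUU scale1r.
Qed.

Lemma tmulU A B (a : A) (b : B) : tmul << a >> << b >> = << (a, b) >> :> {malg K[(A * B)%type]}.
Proof. by rewrite /tmul !lextU. Qed.

End LinearExtension.

Section Permutations.
Variable n : nat.

Fact adj_lt (k : 'I_n.-1) : (k < n)%N.
Proof. by apply: leq_trans (ltn_ord k) (leq_pred n). Qed.

Fact adj_ltS (k : 'I_n.-1) : (k.+1 < n)%N.
Proof. by rewrite -ltn_predRL. Qed.

Definition adj (k : 'I_n.-1) : 'S_n :=
  tperm (Ordinal (adj_lt k)) (Ordinal (adj_ltS k)).

(* w = s_k1 o ... o s_kl, as functions composed from right to left; the product
   of 'S_n composes from left to right, hence the pointwise formulation. *)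
Definition expression (w : 'S_n) (s : seq 'I_n.-1) : bool :=
  [forall x, w x == foldr (fun k y => adj k y) x s].

Lemma expression_cat w1 w2 s1 s2 :
  expression w1 s1 -> expression w2 s2 -> expression (w2 * w1)%g (s1 ++ s2).
Proof.
move=> /forallP h1 /forallP h2; apply/forallP => x.
by rewrite permM foldr_cat -(eqP (h2 x)) -(eqP (h1 _)).
Qed.

Lemma expression_adj k : expression (adj k) [:: k].
Proof. by apply/forallP => x. Qed.

Lemma tperm_expression (a b : 'I_n) : exists s, expression (tperm a b) s.
Proof.
wlog le_ab : a b / (a <= b)%N.
  by move=> h; case: (leqP a b) => [/h//|/ltnW /h]; rewrite tpermC.
move: {2}(b - a)%N (erefl (b - a)%N) => d; elim: d a b le_ab => [|d IH] a b le_ab db.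
  have -> : a = b.
    by apply/val_inj/eqP; rewrite eqn_leq le_ab /= -subn_eq0 db.
  by exists [::]; apply/forallP => x; rewrite tperm1 perm1.
have lt_ab : (a < b)%N by rewrite -subn_gt0 db.
have b0 : (0 < b)%N by apply: leq_ltn_trans lt_ab.
have kP : (b.-1 < n.-1)%N by rewrite ltn_predRL prednK // ltn_ord.
pose k := Ordinal kP; pose c := Ordinal (adj_lt k).
have cE : c = b.-1 :> nat by [].
have bE : Ordinal (adj_ltS k) = b by apply: val_inj; rewrite /= prednK.
have cb : c != b.
  by apply/eqP => h; move: (congr1 val h) => /= /eqP; rewrite -[X in _ == X](prednK b0) -[X in X == _]addn0 -addn1 eqn_add2l.
case: (eqVneq a c) => [ac|ac].
  exists [:: k]; have -> : tperm a b = adj k by rewrite /adj bE ac.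
  exact: expression_adj.
have [s hs] : exists s, expression (tperm a c) s.
  apply: IH; first by rewrite cE -ltnS prednK.
  by rewrite cE -subn1 subnAC db subn1.
exists ([:: k] ++ (s ++ [:: k])).
have -> : tperm a b = ((adj k * tperm a c) * adj k)%g.
  have ab : a != b by apply: contraTneq lt_ab => ->; rewrite ltnn.
  rewrite -[adj k in RHS]tpermV -{1}/(adj k) /adj bE -/c.
  have := tpermJ a c (tperm c b); rewrite /conjg tpermV mulgA => ->.
  by rewrite tpermL tpermD // eq_sym.
apply: expression_cat; first exact: expression_adj.
by apply: expression_cat => //; apply: expression_adj.
Qed.

Lemma expression_ex (w : 'S_n) : exists s, expression w s.
Proof.
have [ts -> _] := prod_tpermP w.
elim: ts => [|t ts [s hs]].
  by exists [::]; apply/forallP => x; rewrite big_nil perm1.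
have [s' hs'] := tperm_expression t.1 t.2.
by exists (s ++ s'); rewrite big_cons; apply: expression_cat.
Qed.

Fact expression_size_ex (w : 'S_n) :
  exists l, [exists s : l.-tuple 'I_n.-1, expression w s].
Proof.
by have [s hs] := expression_ex w; exists (size s); apply/existsP; exists (in_tuple s).
Qed.

Definition perm_length (w : 'S_n) : nat := ex_minn (expression_size_ex w).

Definition reduced_expression (w : 'S_n) (s : seq 'I_n.-1) : bool :=
  expression w s && (size s == perm_length w).

Fact reduced_expression_ex (w : 'S_n) : exists s, reduced_expression w s.
Proof.
rewrite /reduced_expression /perm_length.
case: ex_minnP => l /existsP[s hs] _.
by exists (tval s); rewrite hs size_tuple eqxx.
Qed.

Definition a_reduced_expression (w : 'S_n) : seq 'I_n.-1 :=
  xchoose (reduced_expression_ex w).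

End Permutations.

Section Chi.
Variables i j : nat.

Definition chi_fun (k : 'I_(i + j)) : 'I_(i + j) :=
  cast_ord (addnC j i)
    (match split k with inl a => rshift j a | inr b => lshift i b end).

Fact chi_fun_inj : injective chi_fun.
Proof.
move=> x y /cast_ord_inj; case: (splitP x) => a xE; case: (splitP y) => b yE /eqP.
- rewrite eq_rshift => /eqP ab; apply: ord_inj; by rewrite xE yE ab.
- by rewrite eq_rlshift.
- by rewrite eq_lrshift.
- rewrite eq_lshift => /eqP ab; apply: ord_inj; by rewrite xE yE ab.
Qed.

Definition chi : 'S_(i + j) := perm chi_fun_inj.

End Chi.

Section QuasiShuffle.
Variables (K : fieldType) (V : vectType K) (N : nat) (e : N.-tuple V).
Implicit Types (u v : V) (w : seq 'I_N).

Definition crd v : {malg K['I_N]} := \sum_(i < N) coord e i v *: << i >>.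

Definition tens2 u v : Tsq K N := tmul (crd u) (crd v).

Definition tens (vs : seq V) : Talg K N :=
  foldr (fun v x => lext (fun p => << p.1 :: p.2 >>) (tmul (crd v) x))
        << [::] >> vs.

(* id^(x k) (x) f (x) id on the tensor powers of V of order at least k + 2, for
   f from the tensor square of V to T(V) given on the basis; 0 elsewhere. *)
Definition act_at (k : nat) (f : 'I_N -> 'I_N -> Talg K N) :
    Talg K N -> Talg K N :=
  lext (fun w => if drop k w is a :: b :: t
                 then lext (fun z => << take k w ++ z ++ t >>) (f a b) else 0).

Variable m : V -> V -> V.
Variable sigma : Tsq K N -> Tsq K N.

(* 0-based: sigma_at k is sigma_(k+1), and m_at k is id^(x k) (x) m (x) id. *)
Definition sigma_at (k : nat) : Talg K N -> Talg K N :=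
  act_at k (fun a b => lext (fun p => << [:: p.1; p.2] >>) (sigma << (a, b) >>)).

Definition m_at (k : nat) : Talg K N -> Talg K N :=
  act_at k (fun a b => tens [:: m (tnth e a) (tnth e b)]).

Record braiding : Prop := Braiding {
  braiding_inv : bijective sigma;
  braiding_YB : forall u v w : V, let x := tens [:: u; v; w] in
    sigma_at 0 (sigma_at 1 (sigma_at 0 x)) =
    sigma_at 1 (sigma_at 0 (sigma_at 1 x))
}.

Record YB_algebra (one : V) : Prop := YBAlgebra {
  YB_mulA : associative m;
  YB_mul1 : left_id one m;
  YB_mulr1 : right_id one m;
  YB_braiding : braiding;
  YB_mull : forall u v w : V, let x := tens [:: u; v; w] in
    m_at 1 (sigma_at 0 (sigma_at 1 x)) = sigma_at 0 (m_at 0 x);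
  YB_mulr : forall u v w : V, let x := tens [:: u; v; w] in
    m_at 0 (sigma_at 1 (sigma_at 0 x)) = sigma_at 0 (m_at 1 x);
  YB_unitl : forall v : V, sigma (tens2 one v) = tens2 v one;
  YB_unitr : forall v : V, sigma (tens2 v one) = tens2 one v
}.

Definition Tsigma n (p : 'S_n) (x : Talg K N) : Talg K N :=
  foldr (fun (k : 'I_n.-1) y => sigma_at k y) x (a_reduced_expression p).

Local Notation W := (seq 'I_N).

Definition beta_word (p : W * W) : {malg K[(W * W)%type]} :=
  if (p.1 == [::]) || (p.2 == [::]) then << (p.2, p.1) >>
  else lext (fun z => << (take (size p.2) z, drop (size p.2) z) >>)
            (Tsigma (chi (size p.1) (size p.2)) << p.1 ++ p.2 >>).

Definition beta : {malg K[(W * W)%type]} -> {malg K[(W * W)%type]} := lext beta_word.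

Definition delta_word (w : W) : {malg K[(W * W)%type]} :=
  \sum_(i < (size w).+1) << (take i w, drop i w) >>.

Definition eps_word (w : W) : K := (w == [::])%:R.

Definition Delta_word (p : W * W) : {malg K[((W * W) * (W * W))%type]} :=
  lext (fun t => lext (fun r => << ((t.1.1, r.1), (r.2, t.2.2)) >>)
                      (beta << (t.1.2, t.2.1) >>))
       (tmul (delta_word p.1) (delta_word p.2)).

(* The (n+1)-st tensor power of T(V) (x) T(V) is spanned by the words of size
   n.+1 over W * W. *)
Fixpoint Delta_iter (n : nat) (p : W * W) : {malg K[seq (W * W)]} :=
  if n is n'.+1 then
    lext (fun s => if s is a :: s'
                   then lext (fun r => << r.1 :: r.2 :: s' >>) (Delta_word a)
                   else 0)
         (Delta_iter n' p)
  else << [:: p] >>.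

Definition M_word (p : W * W) : V :=
  match p with
  | ([:: i], [::]) => tnth e i
  | ([::], [:: j]) => tnth e j
  | ([:: i], [:: j]) => m (tnth e i) (tnth e j)
  | _ => 0
  end.

Definition Mpow : {malg K[seq (W * W)]} -> Talg K N :=
  lext (fun s => tens (map M_word s)).

(* The sum over all n >= 1 is cut at n = size p.1 + size p.2: the other terms
   vanish, see Mpow_Delta_iter_eq0. *)
Definition qqs_word (p : W * W) : Talg K N :=
  (eps_word p.1 * eps_word p.2) *: << [::] >> +
  \sum_(1 <= n < (size p.1 + size p.2).+1) Mpow (Delta_iter n.-1 p).

Definition qqs (x y : Talg K N) : Talg K N := lext qqs_word (tmul x y).

End QuasiShuffle.

Section Facts.
Variables (K : fieldType) (V : vectType K) (N : nat) (e : N.-tuple V).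
Local Notation W := (seq 'I_N).

Definition supp_in (A : choiceType) (P : A -> Prop) (x : {malg K[A]}) : Prop :=
  forall a, a \in msupp x -> P a.

Lemma supp_in0 (A : choiceType) (P : A -> Prop) : supp_in P 0.
Proof. by move=> a; rewrite msupp0 in_fset0. Qed.

Lemma supp_inU (A : choiceType) (P : A -> Prop) a : P a -> supp_in P << a >>.
Proof.
by move=> Pa b /(fsubsetP msuppU_le); rewrite in_fset1 => /eqP ->.
Qed.

Lemma supp_in_sum (A : choiceType) (P : A -> Prop) (I : eqType) (r : seq I)
    (F : I -> {malg K[A]}) :
  (forall i, i \in r -> supp_in P (F i)) -> supp_in P (\sum_(i <- r) F i).
Proof.
elim: r => [|i r IH] h; first by rewrite big_nil; apply: supp_in0.
rewrite big_cons => a /(fsubsetP (msuppD_le _ _)); rewrite in_fsetU => /orP[].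
  by apply: h; rewrite inE eqxx.
by apply: IH => j jr; apply: h; rewrite inE jr orbT.
Qed.

Lemma supp_in_lext (A B : choiceType) (P : A -> Prop) (Q : B -> Prop)
    (f : A -> {malg K[B]}) x :
  supp_in P x -> (forall a, P a -> supp_in Q (f a)) -> supp_in Q (lext f x).
Proof.
move=> hx hf; apply: supp_in_sum => a /hx /hf h b /(fsubsetP (msuppZ_le _ _)).
exact: h.
Qed.

Lemma supp_in_tmul (A B : choiceType) (P : A -> Prop) (Q : B -> Prop)
    (x : {malg K[A]}) (y : {malg K[B]}) :
  supp_in P x -> supp_in Q y ->
  supp_in (fun t => P t.1 /\ Q t.2) (tmul x y).
Proof.
move=> hx hy; apply: supp_in_lext hx _ => a Pa.
by apply: supp_in_lext hy _ => b Qb; apply: supp_inU.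
Qed.

Lemma lext_eq0 (A : choiceType) (M : lmodType K) (P : A -> Prop) (f : A -> M)
    (x : {malg K[A]}) :
  supp_in P x -> (forall a, P a -> f a = 0) -> lext f x = 0.
Proof.
move=> hx hf; rewrite /lext big_seq big1 // => a /hx /hf ->.
by rewrite scaler0.
Qed.

Lemma crd_basis (he : free e) i : crd e (tnth e i) = << i >>.
Proof.
rewrite /crd (bigD1 i) //= (tnth_nth 0) coord_free // eqxx scale1r big1 ?addr0 //.
by move=> j ji; rewrite coord_free // eq_sym (negPf ji) scale0r.
Qed.

Lemma tens_basis (he : free e) (w : W) :
  tens e [seq tnth e i | i <- w] = << w >>.
Proof. by elim: w => //= i w IH; rewrite IH crd_basis // tmulU lextU. Qed.

Lemma tens2_basis (he : free e) i j :
  tens2 e (tnth e i) (tnth e j) = << (i, j) >>.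
Proof. by rewrite /tens2 !crd_basis // tmulU. Qed.

Lemma crd0 : crd e 0 = 0.
Proof. by rewrite /crd big1 // => i _; rewrite linear0 scale0r. Qed.

Lemma tens_eq0 (vs : seq V) : 0 \in vs -> tens e vs = 0.
Proof.
elim: vs => //= v vs IH; rewrite inE => /orP[/eqP <-|/IH ->].
  by rewrite crd0 /tmul linear0 linear0.
rewrite (_ : tmul _ 0 = 0) ?linear0 //.
by rewrite /tmul /lext big1 // => a _; rewrite msupp0 big_seq_fset0 scaler0.
Qed.

Variables (m : V -> V -> V) (sigma : Tsq K N -> Tsq K N).

Lemma Tsigma_supp n (p : 'S_n) l (x : Talg K N) :
  supp_in (fun w => size w = l) x ->
  supp_in (fun w => size w = l) (Tsigma sigma p x).
Proof.
move=> hx; rewrite /Tsigma; elim: (a_reduced_expression p) => //= k s IH.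
apply: supp_in_lext IH _ => w sw.
case E: (drop k w) => [|a [|b t]]; try exact: supp_in0.
pose Q (z : W) := size z = 2.
apply: (@supp_in_lext _ _ Q).
  by apply: (@supp_in_lext _ _ (fun=> True)) => // r _; apply: supp_inU.
move=> z zE; apply: supp_inU; rewrite -sw -[in RHS](cat_take_drop k w) E.
by rewrite !size_cat /= zE !addnS.
Qed.

Let tot (p : W * W) : nat := (size p.1 + size p.2)%N.

Lemma beta_word_supp (p : W * W) :
  supp_in (fun r => tot r = tot p) (beta_word sigma p).
Proof.
rewrite /beta_word; case: ifP => _; first by apply: supp_inU; rewrite /tot addnC.
apply: (@supp_in_lext _ _ (fun w => size w = tot p)).
  by apply: Tsigma_supp; apply: supp_inU; rewrite size_cat.
by move=> z zE; apply: supp_inU; rewrite /tot /= -size_cat cat_take_drop.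
Qed.

Lemma delta_word_supp (w : W) : supp_in (fun r => tot r = size w) (delta_word K w).
Proof.
apply: supp_in_sum => i _; apply: supp_inU.
by rewrite /tot /= -size_cat cat_take_drop.
Qed.

Lemma Delta_word_supp (p : W * W) :
  supp_in (fun t => tot t.1 + tot t.2 = tot p)%N (Delta_word sigma p).
Proof.
apply: (supp_in_lext (supp_in_tmul (@delta_word_supp p.1) (@delta_word_supp p.2))).
move=> [[a b] [c d]] /= [h1 h2]; rewrite /beta lextU.
apply: (supp_in_lext (@beta_word_supp (b, c))) => r rE; apply: supp_inU.
move: h1 h2 rE; rewrite /tot /= => h1 h2 rE.
by rewrite -h1 -h2 -!addnA; congr addn; rewrite !addnA rE.
Qed.

Lemma Delta_iter_supp n (p : W * W) :
  supp_in (fun s => size s = n.+1 /\ sumn (map tot s) = tot p)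
          (Delta_iter sigma n p).
Proof.
elim: n => [|n IH] /=; first by apply: supp_inU; rewrite /= addn0.
apply: supp_in_lext IH _ => -[|a s] [] //= ss st.
apply: (supp_in_lext (@Delta_word_supp a)) => r rE; apply: supp_inU.
by rewrite /= ss addnA rE st.
Qed.

Lemma Mpow_Delta_iter_eq0 n (p : W * W) :
  (size p.1 + size p.2 < n)%N -> Mpow e m (Delta_iter sigma n.-1 p) = 0.
Proof.
case: n => // n lt_pn; apply: (lext_eq0 (@Delta_iter_supp n p)) => s [ss st].
apply: tens_eq0; suff h : ([::], [::]) \in s by apply/mapP; exists ([::], [::]).
move: lt_pn; rewrite -/(tot p) -st /= -ss.
elim: s {ss st} => //= a s IH; rewrite inE.
case E: (tot a) => [|t]; last first.
  by rewrite addSn ltnS => h; rewrite IH ?orbT // (leq_ltn_trans (leq_addl t _)).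
by case: a E => [[|? ?] [|? ?]].
Qed.

End Facts.

Section Lyndon.
Variables (K : fieldType) (V : vectType K) (N : nat) (e : N.-tuple V).
Local Notation W := (seq 'I_N).

Definition wle (u v : W) : bool :=
  ((u : seqlexi 'I_N) <= (v : seqlexi 'I_N))%O.

Definition wlt (u v : W) : bool :=
  ((u : seqlexi 'I_N) < (v : seqlexi 'I_N))%O.

Definition lyndon (w : W) : Prop :=
  w <> [::] /\
  forall a b : W, a <> [::] -> b <> [::] -> w = a ++ b -> wlt w b.

Definition Tplus (x : Talg K N) : Prop := x@_[::] = 0.

Definition lyndon_product (m : V -> V -> V) (sigma : Tsq K N -> Tsq K N)
    (x : Talg K N) : Prop :=
  exists (l : W) (ls : seq W),
    [/\ forall w, w \in l :: ls -> lyndon w,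
        sorted (fun u v => wle v u) (l :: ls)
      & x = foldl (fun y w => qqs e m sigma y << w >>) << l >> ls].

End Lyndon.

(* The set S is a basis of the subspace U. *)
Definition is_linear_basis (K : fieldType) (L : lmodType K) (S U : L -> Prop) :
    Prop :=
  [/\ forall x, S x -> U x,
      forall (s : seq L) (c : L -> K), uniq s -> (forall x, x \in s -> S x) ->
        \sum_(x <- s) c x *: x = 0 -> forall x, x \in s -> c x = 0
    & forall y, U y -> exists (s : seq L) (c : L -> K),
        (forall x, x \in s -> S x) /\ y = \sum_(x <- s) c x *: x].

(* Main.v *)
Require Import Defs.
From mathcomp Require Import all_boot all_order all_algebra all_fingroup.
From mathcomp Require Import finmap sesquilinear ring zify.

Set Implicit Arguments.
Unset Strict Implicit.
Unset Printing Implicit Defensive.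

Import Order.TTheory GRing.Theory.
Local Open Scope ring_scope.

(** A diagonal braiding turns the recursion defining the quantum quasi-shuffle
    product into a combinatorial one.  In top degree every factor [M] receives
    exactly one letter, so the product [m] only contributes to shorter words,
    and the coefficient of a word [w] in top degree of the product of [u] and
    [v] is the coefficient [shuffle_coef] of the quantum shuffle: a sum over
    the interleavings of [u] and [v] equal to [w], each weighted by the [q_ij]
    of the pairs of letters that cross (mcoeff_level_top).

    Order words by length, then lexicographically.  Let [u = l_1 ... l_r] with
    Lyndon factors [l_i >= l] and [l] Lyndon.  Every nonempty suffix of [u] is
    then at least [l] (suffixes_ge_flatten), hence the largest interleaving of
    [u] and [l] is [u l] (interleaving_le): greedily, a letter of [l] should
    never be taken before the letters of [u].  It is reached several times only
    through the factors equal to [l] at the end of [u]: if there are [k] of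
    them, the coefficient of [u l] is [1 + Q + ... + Q^k], where
    [Q = cross l l] is the product of the [q_ij] over all pairs of letters of
    [l] (shuffle_coef_max).  As [Q] is a power of [q], it is either [1] or of
    infinite order, so this sum is nonzero (quantum_integer_neq0).

    By induction the leading word of [l_1 * ... * l_r], for
    [l_1 >= ... >= l_r], is the concatenation [l_1 ... l_r]
    (leading_lyndon_product).  Every nonempty word has exactly one factorization
    into a nonincreasing sequence of Lyndon words, so these products form a
    family triangular with respect to the basis of words, hence a basis. *)


(** * Lexicographic order *)

Section Words.
Variable N : nat.
Local Notation W := (seq 'I_N).
Implicit Types (a b c : 'I_N) (u v w x y l p s : W).

Lemma wle_cons a u b v :
  wle (a :: u) (b :: v) = (a < b)%O || ((a == b) && wle u v).
Proof.
rewrite /wle lexi_cons; case: (ltgtP a b) => //=.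
Qed.

Lemma wle0s u : wle [::] u.
Proof. exact: lexi0s. Qed.

Lemma wles0 u : wle u [::] = (u == [::]).
Proof. exact: lexis0. Qed.

Lemma wle_refl u : wle u u.
Proof. exact: lexx. Qed.

Lemma wle_anti u v : wle u v -> wle v u -> u = v.
Proof. by move=> uv vu; apply: (@le_anti _ (seqlexi 'I_N)); apply/andP. Qed.

Lemma wle_trans v u w : wle u v -> wle v w -> wle u w.
Proof. exact: le_trans. Qed.

Lemma wle_eqVlt u v : wle u v = (u == v) || wlt u v.
Proof. exact: le_eqVlt. Qed.

Lemma wltW u v : wlt u v -> wle u v.
Proof. exact: ltW. Qed.

Lemma wltNge u v : wlt u v = ~~ wle v u.
Proof. exact: ltNge. Qed.

Lemma wlt_le_trans v u w : wlt u v -> wle v w -> wlt u w.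
Proof. exact: lt_le_trans. Qed.

Lemma wlt_cons a u b v :
  wlt (a :: u) (b :: v) = (a < b)%O || ((a == b) && wlt u v).
Proof.
by rewrite !wltNge wle_cons; case: (ltgtP a b).
Qed.

Lemma wle_cat2l p u v : wle (p ++ u) (p ++ v) = wle u v.
Proof. by elim: p => //= a p IH; rewrite wle_cons ltxx eqxx. Qed.

Lemma wlt_cat2l p u v : wlt (p ++ u) (p ++ v) = wlt u v.
Proof. by rewrite !wltNge wle_cat2l. Qed.

Lemma wle_prefix u v : wle u (u ++ v).
Proof. by rewrite -{1}[u]cats0 wle_cat2l wle0s. Qed.

(** Past the first difference of two words, nothing matters. *)
Lemma wlt_cat u v x y : wlt u v -> ~~ prefix u v -> wlt (u ++ x) (v ++ y).
Proof.
elim: u v => [|a u IH] [|b v]; rewrite ?prefix0s //=.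
by rewrite !wlt_cons; case: (ltgtP a b) => //= _; apply: IH.
Qed.

Lemma wlt_cat_size u v x y :
  wlt u v -> (size v <= size u)%N -> wlt (u ++ x) (v ++ y).
Proof.
move=> lt_uv le_vu; apply: wlt_cat => //; apply: contraTN lt_uv => /prefixP[z vE].
move: le_vu; rewrite vE size_cat -[X in (_ <= X)%N]addn0 leq_add2l leqn0 size_eq0.
by move/eqP->; rewrite cats0 wltNge wle_refl.
Qed.

(** * Lyndon words *)

(** For [l] a Lyndon word this says that all the Lyndon factors of [u] are at
    least [l], in a form inherited by the suffixes of [u]. *)
Definition suffixes_ge l u := forall p s, u = p ++ s -> s <> [::] -> wle l s.

Lemma suffixes_ge_cat l p u : suffixes_ge l (p ++ u) -> suffixes_ge l u.
Proof. by move=> h p' s uE; apply: (h (p ++ p')); rewrite uE catA. Qed.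

Lemma lyndon_suffix l p s : lyndon l -> l = p ++ s -> s <> [::] -> wle l s.
Proof.
move=> [_ hl] lE s0; case: p lE => [|a p] lE; first by rewrite lE wle_refl.
by apply/wltW/(hl _ _ _ s0 lE).
Qed.

(** A suffix of a product of Lyndon words starts with a suffix of one of the
    factors, and that suffix is at least the factor. *)
Lemma suffixes_ge_flatten l ls :
  (forall k, k \in ls -> lyndon k /\ wle l k) -> suffixes_ge l (flatten ls).
Proof.
elim: ls => [|k ls IH] h p s; first by case: p s => [|? ?] [].
have [klyn lek] := h k (mem_head _ _).
have {}IH : suffixes_ge l (flatten ls).
  by apply: IH => k' k'ls; apply: h; rewrite inE k'ls orbT.
have [le_pk|lt_kp] := leqP (size p) (size k); last first.
  move=> /= kE; apply: (IH (drop (size k) p)).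
  have -> : flatten ls = drop (size k) (p ++ s) by rewrite -kE drop_size_cat.
  by rewrite drop_cat lt_kp.
move=> /= kE s0; have sE : s = drop (size p) k ++ flatten ls.
  rewrite -[LHS](@drop_size_cat _ (size p) p) // -kE.
  rewrite drop_cat; case: ltngtP le_pk => // -> _.
  by rewrite subnn drop0 drop_size.
case: (eqVneq (drop (size p) k) [::]) => [d0|/eqP d0].
  by apply: (IH [::]) => //; rewrite sE d0.
apply: wle_trans lek _; apply: (@wle_trans (drop (size p) k)).
  exact: lyndon_suffix klyn (esym (cat_take_drop (size p) k)) d0.
by rewrite sE wle_prefix.
Qed.

Lemma lyndon1 a : lyndon [:: a].
Proof. by split=> // -[|? [|? ?]] [|? ?]. Qed.

Lemma lyndon_cat u v : lyndon u -> lyndon v -> wlt u v -> lyndon (u ++ v).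
Proof.
move=> ulyn vlyn lt_uv; have [u0 hu] := ulyn; have [v0 hv] := vlyn.
have lt_uvv : wlt (u ++ v) v.
  case: (boolP (prefix u v)) => [/prefixP[z vE]|npre]; last first.
    by rewrite -[X in wlt _ X]cats0; apply: wlt_cat.
  rewrite {2}vE wlt_cat2l; apply: (hv u) => // z0.
  by move: lt_uv; rewrite vE z0 cats0 wltNge wle_refl.
split=> [|p s p0 s0 E]; first by case: (u) u0.
have [lt_pu|le_up] := ltnP (size p) (size u).
  have sE : s = drop (size p) u ++ v.
    by rewrite -[LHS](@drop_size_cat _ (size p) p) // -E drop_cat lt_pu.
  have uE := cat_take_drop (size p) u.
  have tE : take (size p) u = p.
    by rewrite -[RHS](@take_size_cat _ (size p) p s) // -E take_cat lt_pu.
  rewrite tE in uE; rewrite sE; apply: wlt_cat_size; last by rewrite size_drop leq_subr.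
  apply: hu p0 _ (esym uE) => /(congr1 size)/eqP; rewrite size_drop subn_eq0.
  by rewrite leqNgt lt_pu.
apply: wlt_le_trans lt_uvv _; apply: (@lyndon_suffix v (drop (size u) p)) => //.
rewrite -[LHS](@drop_size_cat _ (size u) u) // E drop_cat; case: ltngtP le_up => // -> _.
by rewrite subnn drop0 drop_size.
Qed.

Definition nonincreasing ls := sorted (fun u v => wle v u) ls.

Lemma nonincreasing_rcons ls l :
  nonincreasing (rcons ls l) -> forall k, k \in ls -> wle l k.
Proof.
move=> + k kls; rewrite -cats1 => srt.
have : pairwise (fun u v => wle v u) (ls ++ [:: l]).
  by rewrite -sorted_pairwise // => u v w uv vw; apply: wle_trans vw uv.
rewrite pairwise_cat => /and3P[/allP/(_ k kls) /=].
by rewrite andbT.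
Qed.

(** A new letter absorbs the factors on its right as long as the concatenation
    stays Lyndon, that is, as long as they are larger. *)
Lemma lyndon_factorization w : exists ls,
  [/\ flatten ls = w, forall l, l \in ls -> lyndon l & nonincreasing ls].
Proof.
elim: w => [|a w [ls [<- lslyn srt]]]; first by exists [::].
rewrite -cat1s; move: [:: a] (lyndon1 a) => u ulyn.
elim: ls u ulyn lslyn srt => [|l ls IH] u ulyn lslyn srt.
  by exists [:: u]; split=> // l; rewrite inE => /eqP ->.
case: (boolP (wlt u l)) => [lt_ul|].
  rewrite /= catA; apply: IH.
  - by apply: lyndon_cat => //; apply: lslyn; rewrite mem_head.
  - by move=> k kls; apply: lslyn; rewrite inE kls orbT.
  - exact: path_sorted srt.
rewrite wltNge negbK => le_lu; exists (u :: l :: ls); split=> //.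
  by move=> k; rewrite inE => /predU1P[->//|/lslyn].
by rewrite /nonincreasing /= le_lu.
Qed.

(** The last factor is the smallest nonempty suffix. *)
Lemma lyndon_factorization_uniq ls ls' :
  (forall l, l \in ls -> lyndon l) -> (forall l, l \in ls' -> lyndon l) ->
  nonincreasing ls -> nonincreasing ls' -> flatten ls = flatten ls' -> ls = ls'.
Proof.
have nil_flat ks : (forall l, l \in ks -> lyndon l) -> flatten ks = [::] -> ks = [::].
  case: ks => // k ks /(_ k (mem_head _ _)) [k0 _] /= /(congr1 size)/eqP.
  by rewrite size_cat addn_eq0 size_eq0 => /andP[/eqP].
have last_min ks k p s : (forall l, l \in rcons ks k -> lyndon l) ->
    nonincreasing (rcons ks k) -> flatten (rcons ks k) = p ++ s -> s <> [::] ->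
    wle k s.
  move=> lyn srt E s0; apply: (suffixes_ge_flatten _ E) => // l lks.
  split; first exact: lyn.
  move: lks; rewrite mem_rcons inE => /predU1P[->|]; first exact: wle_refl.
  exact: (nonincreasing_rcons srt).
elim/last_ind: ls ls' => [|ls l IH] ls' lyn lyn' srt srt' E.
  by apply/esym/nil_flat.
case/lastP: ls' E lyn' srt' => [|ls' l'] E lyn' srt'; first exact: nil_flat.
have ll' : l = l'.
  have hl : lyndon l by apply: lyn; rewrite mem_rcons mem_head.
  have hl' : lyndon l' by apply: lyn'; rewrite mem_rcons mem_head.
  apply: wle_anti.
    by apply: (last_min ls _ (flatten ls')) => //; [rewrite E flatten_rcons | case: hl'].
  by apply: (last_min ls' _ (flatten ls)) => //; [rewrite -E flatten_rcons | case: hl].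
subst l'; congr rcons; apply: IH.
- by move=> k kls; apply: lyn; rewrite mem_rcons inE kls orbT.
- by move=> k kls; apply: lyn'; rewrite mem_rcons inE kls orbT.
- by move: srt; rewrite /nonincreasing -cats1 => /cat_sorted2[].
- by move: srt'; rewrite /nonincreasing -cats1 => /cat_sorted2[].
move: E; rewrite !flatten_rcons => E; apply/eqP.
have sE : size (flatten ls) = size (flatten ls').
  by apply/eqP; move/(congr1 size)/eqP: E; rewrite !size_cat eqn_add2r.
by move/eqP: E; rewrite eqseq_cat // => /andP[].
Qed.

End Words.

(** * Interleavings *)

Section Interleavings.
Variable N : nat.
Local Notation W := (seq 'I_N).
Implicit Types (a b c : 'I_N) (u v w x y l p s : W).

Inductive interleaving : W -> W -> W -> Prop :=
| InterleavingNil : interleaving [::] [::] [::]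
| InterleavingLeft a u v w :
    interleaving u v w -> interleaving (a :: u) v (a :: w)
| InterleavingRight b u v w :
    interleaving u v w -> interleaving u (b :: v) (b :: w).

Lemma interleaving_cons u v c w : interleaving u v (c :: w) ->
  (exists2 u', u = c :: u' & interleaving u' v w) \/
  (exists2 v', v = c :: v' & interleaving u v' w).
Proof.
move E: (c :: w) => z h; case: h E => // [a u' v' w' h|b u' v' w' h] [-> ->].
  by left; exists u'.
by right; exists v'.
Qed.

Lemma interleaving_nil u v : interleaving u v [::] -> u = [::] /\ v = [::].
Proof. by move E: [::] => z h; case: h E. Qed.

Lemma interleaving0r v : interleaving [::] v v.
Proof. by elim: v => [|b v IH]; constructor. Qed.

Lemma interleaving0r_eq v w : interleaving [::] v w -> w = v.
Proof.
elim: w v => [|c w IH] v; first by case/interleaving_nil.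
by case/interleaving_cons => [[]//|[v' -> /IH ->]].
Qed.

Lemma interleaving0l_eq u w : interleaving u [::] w -> w = u.
Proof.
elim: w u => [|c w IH] u; first by case/interleaving_nil.
by case/interleaving_cons => [[u' -> /IH ->]|[]].
Qed.

Lemma interleaving_cat p u v w :
  interleaving u v w -> interleaving (p ++ u) v (p ++ w).
Proof. by move=> h; elim: p => //= a p IH; constructor. Qed.

(** The two words of the same length are interleaved with [v] following the
    same pattern. *)
Lemma interleaving_lt u u' v w : size u = size u' -> wlt u u' ->
  interleaving u v w -> exists2 w', interleaving u' v w' & wlt w w'.
Proof.
move=> + + h; elim: h u' => {u v w} [|a u v w h IH|b u v w h IH] u'.
- by move/esym/size0nil ->; rewrite wltNge wle0s.
- case: u' => // a' u' [su]; rewrite wlt_cons => /orP[lt_aa|/andP[/eqP <- lt_uu]].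
    have [w' h'] : exists w', interleaving u' v w'.
      by exists (u' ++ v); rewrite -{1}[u']cats0; apply/interleaving_cat/interleaving0r.
    by exists (a' :: w'); [constructor | rewrite wlt_cons lt_aa].
  have [w' h' lt_ww] := IH _ su lt_uu.
  by exists (a :: w'); [constructor | rewrite wlt_cons eqxx lt_ww orbT].
move=> su lt_uu; have [w' h' lt_ww] := IH _ su lt_uu.
by exists (b :: w'); [constructor | rewrite wlt_cons eqxx lt_ww orbT].
Qed.

(** Moving a prefix [p] from the front of the larger of two words to the front
    of the smaller one can only enlarge the interleavings.  The letters that [y] yields before
    [p] is exhausted are matched by letters of [x], which then join [p]; this
    is why the prefix is arbitrary. *)
Lemma interleaving_shift p x y w : wle y x -> interleaving (p ++ x) y w ->
  exists2 w', interleaving x (p ++ y) w' & wle w w'.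
Proof.
have [n] := ubnP (size w).
elim: n p x y w => // n IH p x y w; rewrite ltnS => sw le_yx.
case: p => [|a p] h; first by exists w; rewrite ?wle_refl.
case: w sw h => [|c w] sw; first by case/interleaving_nil.
case/interleaving_cons => [[u' [<- <-] h]|[y' yE h]].
  have [w' h' le_ww] := IH p x y w sw le_yx h.
  by exists (a :: w'); [constructor | rewrite wle_cons eqxx le_ww orbT].
subst y; case: x le_yx h => [|d x] le_yx h; first by rewrite wles0 in le_yx.
move: le_yx; rewrite wle_cons => /orP[lt_cd|/andP[/eqP cd le_yx]].
  exists (d :: x ++ ((a :: p) ++ c :: y')); last by rewrite wle_cons lt_cd.
  by constructor; rewrite -{1}[x]cats0; apply/interleaving_cat/interleaving0r.
subst d; have [w' h' le_ww] : exists2 w', interleaving x (rcons (a :: p) c ++ y') w' & wle w w'.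
  by apply: IH => //; rewrite cat_rcons.
exists (c :: w'); last by rewrite wle_cons eqxx le_ww orbT.
by constructor; rewrite -cat_rcons.
Qed.

(** As long as the rest of [u] is at least [l], nothing is gained by taking a
    letter of [l] first. *)
Lemma interleaving_le u l w :
  suffixes_ge l u -> interleaving u l w -> wle w (u ++ l).
Proof.
elim: u w => [|a u IH] w hu; first by move/interleaving0r_eq ->; apply: wle_refl.
have hu' : suffixes_ge l u by apply: (@suffixes_ge_cat _ _ [:: a]).
case: w => [|c w] h; first exact: wle0s.
case/interleaving_cons: h => [[u' [<- <-] h]|[l' lE h]].
  by rewrite /= wle_cons eqxx IH // orbT.
have : wle l (a :: u) by apply: (hu [::]).
rewrite lE !wle_cons => /orP[-> //|/andP[/eqP ca le_lu]]; subst c.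
have [w' h' le_ww] := @interleaving_shift [:: a] u l' w le_lu h.
by rewrite eqxx (wle_trans le_ww) ?orbT //= -lE; apply: IH; rewrite // lE.
Qed.

Definition power l j := flatten (nseq j l).

Lemma size_power l j : size (power l j) = (j * size l)%N.
Proof. by elim: j => //= j IH; rewrite size_cat IH mulSn. Qed.

Lemma cat_inj p : injective (cat p : W -> W).
Proof. by move=> x y /eqP; rewrite eqseq_cat // eqxx => /eqP. Qed.

Lemma suffixes_ge_size l u p y : suffixes_ge l u -> u <> [::] -> l = p ++ y ->
  prefix u p -> u = l.
Proof.
move=> hu u0 lE /prefixP[z pE]; apply: wle_anti; last exact: (hu [::]).
by rewrite lE pE -catA wle_prefix.
Qed.

Lemma commute_power l u : l <> [::] -> suffixes_ge l u -> u ++ l = l ++ u ->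
  exists j, u = power l j.
Proof.
move=> l0; have [n] := ubnP (size u); elim: n u => // n IH u su hu E.
have [->|/eqP u0] := eqVneq u [::]; first by exists 0%N.
have [lt_ul|le_lu] := ltnP (size u) (size l).
  suff /(congr1 size) : u = l by move: lt_ul => /[swap] ->; rewrite ltnn.
  apply: (@suffixes_ge_size l u l [::]); rewrite ?cats0 //.
  apply/prefixP; exists (drop (size u) l).
  rewrite -{1}(cat_take_drop (size u) l); congr (_ ++ _).
  by rewrite -[RHS](@take_size_cat _ (size u) u l) // E take_cat lt_ul.
have uE : u = l ++ drop (size l) u.
  rewrite -{1}(cat_take_drop (size l) u); congr (_ ++ _).
  rewrite -[RHS](@take_size_cat _ (size l) l u) // -E take_cat.
  by case: ltngtP le_lu => // ->; rewrite subnn take0 cats0 take_size.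
have l_gt0 : (0 < size l)%N by case: (l) l0.
have [||| j xE] := IH (drop (size l) u).
- by rewrite size_drop; lia.
- by apply: (@suffixes_ge_cat _ _ l); rewrite -uE.
- by move: E; rewrite {1 2}uE -catA => /cat_inj.
by exists j.+1; rewrite uE xE.
Qed.

Lemma interleaving_block u v w : interleaving u v w -> exists p y w1,
  [/\ v = p ++ y, w = p ++ w1 &
      (y = [::] /\ w1 = u) \/
      (y <> [::] /\ exists a u' w2,
         [/\ u = a :: u', w1 = a :: w2 & interleaving u' y w2])].
Proof.
elim=> {u v w} [|a u v w h _|b u v w h [p [y [w1 [-> -> H]]]]].
- by exists [::], [::], [::]; split=> //; left.
- exists [::], v, (a :: w); split=> //; case: v h => [|b v] h.
    by left; rewrite (interleaving0l_eq h).
  by right; split=> //; exists a, u, w.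
by exists (b :: p), y, w1.
Qed.

(** If [l] is a Lyndon word, cutting it in an interleaving that starts with it
    cannot give [u ++ l]: moving the part [p] already used across
    (interleaving_shift) shows by induction that [u = p l^j], where [l = p y],
    hence that [y <= l^j].  But [y > l] by the Lyndon property, and as [y] is
    shorter than [l] the two words differ at a letter, so [y > l^j]. *)
Lemma lyndon_uncut l u a p y w : lyndon l -> suffixes_ge l (a :: u) ->
  l = p ++ y -> p <> [::] -> y <> [::] -> interleaving u y w ->
  p ++ a :: w <> (a :: u) ++ l.
Proof.
move=> llyn; have [l0 hl] := llyn.
have [n] := ubnP (size u); elim: n u a p y w => // n IH u a p y w su hu lE p0 y0 h E.
have y_gt0 : (0 < size y)%N by case: (y) y0.
have le_pu : (size p <= size (a :: u))%N.
  rewrite leqNgt; apply/negP => lt_up.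
  suff /(congr1 size) : a :: u = l by rewrite lE size_cat; lia.
  apply: (suffixes_ge_size hu _ lE) => //.
  rewrite prefixE -[X in _ == X](@take_size_cat _ (size (a :: u)) _ l) // -E.
  by rewrite take_cat lt_up.
have uE : a :: u = p ++ drop (size p) (a :: u).
  rewrite -{1}(cat_take_drop (size p) (a :: u)); congr (_ ++ _).
  rewrite -[RHS](@take_size_cat _ (size p) p (a :: w)) // E take_cat.
  by case: ltngtP le_pu => // ->; rewrite subnn take0 cats0 take_size.
move: (drop _ _) uE => x uE; rewrite uE -catA in E.
have {}E : a :: w = x ++ l by move: E => /cat_inj.
case: p uE lE p0 {le_pu} => // _ p [<- uE] lE _; rewrite uE in h.
have le_yx : wle y x.
  by have := hu [::] (a :: u) erefl; rewrite lE uE wle_cat2l; apply.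
have [w2 h2 le_ww] := interleaving_shift le_yx h.
have hx : suffixes_ge l x by apply: (@suffixes_ge_cat _ _ (a :: p)); rewrite /= -uE.
have w2E : w2 = w.
  apply: wle_anti le_ww.
  have : wle (a :: w2) (x ++ l).
    by apply: interleaving_le => //; rewrite lE; constructor.
  by rewrite -E wle_cons ltxx eqxx.
rewrite w2E in h2.
have [j xE] : exists j, x = power l j.
  have [p1 [y1 [w1 [lE1 wE]]]] := interleaving_block h2.
  have {}lE1 : l = (a :: p1) ++ y1 by rewrite lE /= lE1.
  case=> [[y10 w1E]|[y10 [c [x' [w3 [xE w1E h3]]]]]].
    apply: commute_power => //; rewrite -E wE w1E.
    by rewrite [in RHS]lE1 y10 cats0.
  have sx : (size x' < n)%N by move: su; rewrite uE xE size_cat /=; lia.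
  case: (IH x' c (a :: p1) y1 w3 sx _ lE1) => //; first by rewrite -xE.
  by rewrite -xE -E wE w1E.
case: j xE => [|j] xE; first by rewrite xE wles0 in le_yx; apply/y0/eqP.
have : wlt (power l j.+1) (y ++ [::]).
  apply: wlt_cat_size; first exact: (hl (a :: p)).
  by rewrite lE size_cat leq_addl.
by rewrite cats0 wltNge -xE le_yx.
Qed.

End Interleavings.

(** * Coefficients of the quantum shuffle *)

Section ShuffleCoef.
Variables (K : fieldType) (N : nat) (qq : 'I_N -> 'I_N -> K).
Local Notation W := (seq 'I_N).
Implicit Types (a b c : 'I_N) (u v w x y l p s : W).

Definition cross u v : K := \prod_(a <- u) \prod_(b <- v) qq a b.

Lemma cross0l v : cross [::] v = 1.
Proof. by rewrite /cross big_nil. Qed.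

Lemma cross0r u : cross u [::] = 1.
Proof. by rewrite /cross big1 // => a _; rewrite big_nil. Qed.

Lemma cross_cons u a v : cross (a :: u) v = cross [:: a] v * cross u v.
Proof. by rewrite /cross !big_cons big_nil mulr1. Qed.

Lemma cross_catl u u' v : cross (u ++ u') v = cross u v * cross u' v.
Proof. by rewrite /cross big_cat. Qed.

Lemma cross_catr u v v' : cross u (v ++ v') = cross u v * cross u v'.
Proof. by rewrite /cross -big_split; apply: eq_bigr => a _; rewrite big_cat. Qed.

Lemma cross_consr u b v : cross u (b :: v) = cross u [:: b] * cross u v.
Proof. by rewrite -cat1s cross_catr. Qed.

Lemma cross_belast a u v :
  cross (a :: u) v = cross (belast a u) v * cross [:: last a u] v.
Proof. by rewrite lastI -cats1 cross_catl. Qed.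

Lemma cross_powerl j l v : cross (power l j) v = cross l v ^+ j.
Proof.
by elim: j => [|j IH]; rewrite ?cross0l // cross_catl IH exprS.
Qed.

(** The coefficient of [w] in the quantum shuffle of [u] and [v]: a letter of
    [v] passes all the letters of [u] that come after it. *)
Fixpoint shuffle_coef w u v : K :=
  if w is c :: w' then
    (if u is a :: u' then (a == c)%:R * shuffle_coef w' u' v else 0) +
    (if v is b :: v' then (b == c)%:R * cross u [:: b] * shuffle_coef w' u v'
     else 0)
  else ((u == [::]) && (v == [::]))%:R.

Lemma shuffle_coef_interleaving w u v :
  shuffle_coef w u v != 0 -> interleaving u v w.
Proof.
elim: w u v => [|c w IH] u v /=.
  by case: u v => [|a u] [|b v]; rewrite /= ?eqxx //; constructor.
have [->|h] := eqVneq (if u is a :: u' then (a == c)%:R * shuffle_coef w u' v else 0) 0.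
  rewrite add0r; case: v => [|b v]; first by rewrite eqxx.
  case: (eqVneq b c) => [->|_]; last by rewrite !mul0r eqxx.
  by rewrite mul1r mulf_eq0 negb_or => /andP[_ /IH]; constructor.
move=> _; case: u h => [|a u]; first by rewrite eqxx.
case: (eqVneq a c) => [->|_]; last by rewrite !mul0r eqxx.
by rewrite mul1r => /IH; constructor.
Qed.

Lemma shuffle_coef_nilr w u : shuffle_coef w u [::] = (w == u)%:R.
Proof.
elim: w u => [|c w IH] [|a u] //=; rewrite ?addr0 // IH eqseq_cons eq_sym.
by rewrite -natrM mulnb.
Qed.

(** The quasi-shuffle product is computed from its last letters, whereas
    lexicographic comparison reads the first ones; the sum over the
    interleavings can be organized either way. *)
Lemma shuffle_coef_rcons w c u v : shuffle_coef (rcons w c) u v =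
  (if u is a :: u' then
     (last a u' == c)%:R * cross [:: last a u'] v * shuffle_coef w (belast a u') v
   else 0) +
  (if v is b :: v' then (last b v' == c)%:R * shuffle_coef w u (belast b v')
   else 0).
Proof.
elim: w u v => [|d w IH] u v.
  case: u => [|a [|a' u]]; case: v => [|b [|b' v]] //=;
    by rewrite ?cross0r ?cross0l; ring.
rewrite rcons_cons; case: u => [|a [|a' u]]; case: v => [|b [|b' v]] /=; rewrite ?IH /=.
all: rewrite ?cross0r ?[cross _ [:: _, _ & _]]cross_consr.
all: rewrite ?[cross [:: _, _ & _] _]cross_cons ?[cross (_ :: belast _ _) _]cross_cons.
all: by rewrite ?(cross_belast a') ?cross0l; ring.
Qed.

Section Power.
Variable l : W.
Hypothesis llyn : lyndon l.

Let l0 : l <> [::]. Proof. by case: llyn. Qed.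

(** Once an interleaving giving [u ++ l] starts with a letter of [l], it has to
    go on with the rest [y] of [l] (lyndon_uncut). *)
Lemma shuffle_coef_block p y u w : l = p ++ y -> p <> [::] ->
  suffixes_ge l u -> p ++ w = u ++ l ->
  shuffle_coef w u y = (w == y ++ u)%:R * cross u y.
Proof.
elim: y p w => [|b y IH] p w lE p0 hu E.
  by rewrite cross0r mulr1 shuffle_coef_nilr.
case: w E => [|c w] E /=; first by rewrite andbF mul0r.
have -> : (if u is a :: u' then (a == c)%:R * shuffle_coef w u' (b :: y) else 0) = 0.
  case uE: u => [//|a u']; rewrite uE in hu E.
  case: eqP => [ac|]; last by rewrite mul0r.
  rewrite mul1r; apply/eqP; rewrite -[_ == 0]negbK; apply/negP.
  move/shuffle_coef_interleaving => h.
  have y0 : b :: y <> [::] by [].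
  by case: (lyndon_uncut llyn hu lE p0 y0 h); rewrite -E ac.
rewrite add0r eqseq_cons eq_sym; case: eqP => [bc|]; last by rewrite !mul0r.
have rp0 : rcons p b <> [::] by case: (p).
rewrite (IH _ w _ rp0) ?cat_rcons // -?bc // mul1r /=.
by rewrite bc [in RHS]cross_consr mulrCA.
Qed.

Lemma shuffle_coef_cons a u : suffixes_ge l (a :: u) ->
  shuffle_coef ((a :: u) ++ l) (a :: u) l =
  shuffle_coef (u ++ l) u l +
  ((a :: u) ++ l == l ++ a :: u)%:R * cross (a :: u) l.
Proof.
move=> hu; have [b [l' lE]] : exists b l', l = b :: l'.
  by case: (l) l0 => // b l' _; exists b, l'.
have : shuffle_coef ((a :: u) ++ l) (a :: u) (b :: l') =
  (a == a)%:R * shuffle_coef (u ++ l) u (b :: l') +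
  (b == a)%:R * cross (a :: u) [:: b] * shuffle_coef (u ++ l) (a :: u) l' by [].
rewrite -lE => ->; rewrite eqxx mul1r [in RHS]lE /= eqseq_cons (eq_sym a b) -lE.
congr (_ + _); case: eqP => [ba|]; last by rewrite !mul0r.
rewrite (@shuffle_coef_block [:: b] l') //; last by rewrite ba.
by rewrite mul1r mulrCA -cross_consr -lE.
Qed.

(** Besides the interleavings that take the first letter of [u] first, only the
    one that starts with the whole of [l] can give [u ++ l], and only when [u]
    is a power of [l]; it then contributes a power of [cross l l]. *)
Lemma shuffle_coef_max u : suffixes_ge l u -> exists k,
  [/\ suffix (power l k) u, forall j, suffix (power l j) u -> (j <= k)%N
    & shuffle_coef (u ++ l) u l = \sum_(i < k.+1) cross l l ^+ i].
Proof.
have l_gt0 : (0 < size l)%N by case: (l) l0.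
have suffix_power_le j v : suffix (power l j) v -> (j * size l <= size v)%N.
  by move/size_suffix; rewrite size_power.
elim: u => [|a u IH] hu.
  exists 0%N; rewrite big_ord1 expr0; split=> //.
    by move=> j /suffix_power_le; case: j => // j; case: (size l) l_gt0.
  rewrite cat0s; elim: (l) => //= b w IH.
  by rewrite eqxx mul1r cross0l mul1r add0r.
have [k [sk kmax ck]] := IH (@suffixes_ge_cat _ _ [:: a] _ hu).
have [E|nE] := eqVneq ((a :: u) ++ l) (l ++ a :: u).
  have [[|j] uE] := commute_power l0 hu E; first by [].
  have jk : j = k.
    have sj : suffix (power l j) u.
      case lE: l l0 => [//|b l'] _; move: uE; rewrite lE => -[_ ->].
      exact: suffix_suffix.
    have su := congr1 size uE; rewrite size_power /= in su.
    apply/eqP; rewrite eqn_leq kmax //= -ltnS -(ltn_pmul2r l_gt0).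
    by rewrite -su ltnS suffix_power_le.
  exists k.+1; rewrite -jk -uE; split=> [|i /suffix_power_le|].
  - exact: suffix_refl.
  - by rewrite uE size_power leq_pmul2r.
  rewrite shuffle_coef_cons // E eqxx mul1r ck [in RHS]big_ord_recr -jk.
  by congr (_ + _); rewrite uE cross_powerl.
exists k; split=> [|j|].
- by apply: suffix_trans sk _; apply: suffix_cons.
- move=> /suffixP[[|c t] uE]; last by case: uE => _ uE; apply/kmax/suffixP; exists t.
  case/negP: nE; rewrite uE /=.
  by elim: (j) => [|i IHi]; rewrite /= ?cats0 // -catA (eqP IHi).
by rewrite shuffle_coef_cons // (negPf nE) mul0r addr0 ck.
Qed.
End Power.

End ShuffleCoef.

(** * Reduced expressions and inversions *)

Section Swap.
Variable T : eqType.
Implicit Types (l : seq T) (k : nat) (x : T).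

Fixpoint swap k l : seq T :=
  match k, l with
  | 0, a :: b :: t => b :: a :: t
  | k'.+1, a :: l' => a :: swap k' l'
  | _, _ => l
  end.

Lemma swapK k : involutive (swap k).
Proof. by elim: k => [|k IH] [|a [|b l]] //=; rewrite IH. Qed.

Lemma swap_cat p a b t : swap (size p) (p ++ a :: b :: t) = p ++ b :: a :: t.
Proof. by elim: p => //= c p ->. Qed.

Lemma perm_swap k l : perm_eq (swap k l) l.
Proof.
elim: k l => [|k IH] [|a l] //=; last by rewrite perm_cons IH.
by case: l => // b l; exact/permPl/(perm_catCA [:: b] [:: a]).
Qed.

Lemma size_swap k l : size (swap k l) = size l.
Proof. exact/perm_size/perm_swap. Qed.

Lemma nth_swap x0 k l i : (k.+1 < size l)%N ->
  nth x0 (swap k l) i =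
  nth x0 l (if i == k then k.+1 else if i == k.+1 then k else i).
Proof.
elim: k l i => [|k IH] [|a [|b l]] //= [|[|i]] //= lt_k.
all: by rewrite (IH (b :: l)) // !eqSS; do 2!case: ifP => //.
Qed.

End Swap.

Lemma map_swap (T T' : eqType) (f : T -> T') k (l : seq T) :
  map f (swap k l) = swap k (map f l).
Proof. by elim: k l => [|k IH] [|a [|b l]] //=; rewrite IH. Qed.

(** The labels are initial positions.  An inversion is listed with the smaller
    label first, because the letter that starts on the left is the left index
    of the factor [q_ij] that the crossing contributes. *)
Fixpoint invs (l : seq nat) : seq (nat * nat) :=
  if l is a :: l' then [seq (b, a) | b <- l' & (b < a)%N] ++ invs l' else [::].

Lemma invs_swap k l : (k.+1 < size l)%N -> (nth 0%N l k < nth 0%N l k.+1)%N ->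
  perm_eq (invs (swap k l)) ((nth 0%N l k, nth 0%N l k.+1) :: invs l).
Proof.
elim: k l => [|k IH] [|a [|b l]] //= lt_k lt_ab.
  rewrite lt_ab ltnNge (ltnW lt_ab) /= perm_cons.
  exact/permPl/perm_catCA.
have pl := perm_map (pair^~ a) (perm_filter (fun c => (c < a)%N) (perm_swap k (b :: l))).
apply: perm_trans (perm_cat pl (IH (b :: l) lt_k lt_ab)) _.
exact/permPl/(perm_catCA _ [:: _]).
Qed.

Lemma invs_swap_desc k l : (k.+1 < size l)%N -> (nth 0%N l k.+1 < nth 0%N l k)%N ->
  perm_eq (invs l) ((nth 0%N l k.+1, nth 0%N l k) :: invs (swap k l)).
Proof.
move=> lt_k lt_l; rewrite -{1}(swapK k l).
have nk : nth 0%N (swap k l) k = nth 0%N l k.+1 by rewrite nth_swap // eqxx.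
have nkS : nth 0%N (swap k l) k.+1 = nth 0%N l k.
  by rewrite nth_swap // eqxx eqn_leq ltnn.
by rewrite -nk -nkS; apply: invs_swap; rewrite ?size_swap // nk nkS.
Qed.

Lemma unsorted_desc l : ~~ sorted leq l ->
  exists2 k, (k.+1 < size l)%N & (nth 0%N l k.+1 < nth 0%N l k)%N.
Proof.
elim: l => [|a [|b l] IH] //=; rewrite negb_and -ltnNge.
by case: (ltnP b a) => [lt_ba _|_ /= /IH[k]]; [exists 0%N | exists k.+1].
Qed.

Lemma filter_lt_iota c m d : (c <= m)%N -> [seq b <- iota m d | (b < c)%N] = [::].
Proof.
move=> le_cm; rewrite -(@eq_in_filter _ pred0) ?filter_pred0 // => b.
by rewrite mem_iota /= => /andP[le_mb _]; rewrite ltnNge (leq_trans le_cm).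
Qed.

Lemma invs_iota m d : invs (iota m d) = [::].
Proof. by elim: d m => //= d IH m; rewrite IH filter_lt_iota. Qed.

Lemma invs_cat_iota m j i : (i <= m)%N ->
  invs (iota m j ++ iota 0 i) =
  [seq (b, a) | a <- iota m j, b <- iota 0 i].
Proof.
elim: j m => [|j IH] m le_im; first by rewrite invs_iota.
rewrite /= IH ?(leqW le_im) // filter_cat filter_lt_iota // cat0s.
congr (map _ _ ++ _); apply/all_filterP/allP => b.
by rewrite mem_iota add0n => /= lt_bi; apply: leq_trans le_im.
Qed.

Section Expressions.
Variable n : nat.
Implicit Types (s : seq 'I_n.-1) (L : seq nat).

Definition swaps (T : eqType) (s : seq 'I_n.-1) (l : seq T) : seq T :=
  foldr (fun k : 'I_n.-1 => swap k) l s.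

Lemma perm_swaps (T : eqType) s (l : seq T) : perm_eq (swaps s l) l.
Proof.
by elim: s => //= k s IH; apply: perm_trans IH; apply: perm_swap.
Qed.

Lemma size_swaps (T : eqType) s (l : seq T) : size (swaps s l) = size l.
Proof. exact/perm_size/perm_swaps. Qed.

Lemma nth_swaps (T : eqType) (x0 : T) s (l : seq T) (x : 'I_n) : size l = n ->
  nth x0 (swaps s l) (foldr (fun k y => adj k y) x s) = nth x0 l x.
Proof.
move=> sl; elim: s => //= k s <-.
rewrite nth_swap ?size_swaps ?sl ?adj_ltS //; congr nth.
rewrite /adj; case: tpermP => [->|->|/eqP + /eqP] /=; rewrite ?eqxx //.
  by rewrite eqn_leq ltnn.
by rewrite -!val_eqE /= => /negPf -> /negPf ->.
Qed.

Lemma invs_swaps_le s L : uniq L -> size L = n ->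
  (size (invs (swaps s L)) <= size (invs L) + size s)%N.
Proof.
move=> uL sL; elim: s => [|k s IH] /=; first by rewrite addn0.
rewrite addnS; set l := swaps s L in IH *.
have lt_k : (k.+1 < size l)%N by rewrite size_swaps sL adj_ltS.
have ul : uniq l by rewrite (perm_uniq (perm_swaps _ _)).
have [lt_l|lt_l|/eqP] := ltngtP (nth 0%N l k) (nth 0%N l k.+1).
- by rewrite (perm_size (invs_swap lt_k lt_l)).
- by apply/leqW/ltnW; move: IH; rewrite (perm_size (invs_swap_desc lt_k lt_l)).
by rewrite nth_uniq ?(ltnW lt_k) // eqn_leq ltnn andbF.
Qed.

(** Bubble sort: any arrangement of the labels is reached by a sequence of
    adjacent transpositions that creates one inversion at each step. *)
Lemma swaps_ex L : perm_eq L (iota 0 n) ->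
  exists2 s, swaps s (iota 0 n) = L & size s = size (invs L).
Proof.
have [d] := ubnP (size (invs L)); elim: d L => // d IH L; rewrite ltnS => sd pL.
have [srt|/unsorted_desc[k lt_k lt_L]] := boolP (sorted leq L).
  have -> : L = iota 0 n.
    by apply: (sorted_eq leq_trans anti_leq) => //; apply: iota_sorted.
  by exists [::]; rewrite // invs_iota.
have sL : size L = n by rewrite (perm_size pL) size_iota.
have kP : (k < n.-1)%N by rewrite ltn_predRL -sL.
have pk := invs_swap_desc lt_k lt_L.
have [||s sE ss] := IH (swap k L).
- by move: sd; rewrite (perm_size pk).
- exact: perm_trans (perm_swap k L) pL.
by exists (Ordinal kP :: s); rewrite /= ?sE ?swapK // ss (perm_size pk).
Qed.

End Expressions.

Section Chi.
Variables i j : nat.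

(** The labels as [chi i j] arranges them: the entry at position [c] is the
    initial position of the letter that ends at [c]. *)
Definition chi_labels := iota i j ++ iota 0 i.

Lemma nth_chi_labels (x : 'I_(i + j)) : nth 0%N chi_labels (chi i j x) = x.
Proof.
rewrite permE /chi_fun nth_cat size_iota.
case: (splitP x) => a xE /=; rewrite xE.
  by rewrite ltnNge leq_addr /= addKn nth_iota.
by rewrite ltn_ord nth_iota.
Qed.

Lemma size_chi_labels : size chi_labels = (i + j)%N.
Proof. by rewrite size_cat !size_iota addnC. Qed.

Lemma perm_chi_labels : perm_eq chi_labels (iota 0 (i + j)).
Proof. by rewrite iotaD add0n perm_catC. Qed.

Lemma size_invs_chi_labels : size (invs chi_labels) = (i * j)%N.
Proof. by rewrite invs_cat_iota // size_allpairs !size_iota mulnC. Qed.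

(** A permutation is determined by how it arranges distinct labels. *)
Lemma expression_chi_swaps (s : seq 'I_(i + j).-1) :
  expression (chi i j) s <-> swaps s (iota 0 (i + j)) = chi_labels.
Proof.
have sl : size (swaps s (iota 0 (i + j))) = (i + j)%N by rewrite size_swaps size_iota.
have nthE (x : 'I_(i + j)) := nth_swaps 0%N s x (size_iota 0 (i + j)).
split=> [/forallP h|E].
  apply: (@eq_from_nth _ 0%N) => [|y lt_y]; first by rewrite sl size_chi_labels.
  rewrite sl in lt_y; pose x := ((chi i j)^-1)%g (Ordinal lt_y).
  have -> : y = chi i j x by rewrite permKV.
  by rewrite nth_chi_labels (eqP (h x)) nthE nth_iota.
apply/forallP => x; rewrite -val_eqE /=.
have uL : uniq chi_labels by rewrite (perm_uniq perm_chi_labels) iota_uniq.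
rewrite -(nth_uniq 0%N _ _ uL) ?size_chi_labels ?ltn_ord //.
by rewrite nth_chi_labels -E nthE nth_iota.
Qed.

(** The length of a permutation is its number of inversions. *)
Lemma size_reduced_chi (s : seq 'I_(i + j).-1) :
  reduced_expression (chi i j) s -> size s = (i * j)%N.
Proof.
case/andP => /expression_chi_swaps sE /eqP; rewrite /perm_length.
case: ex_minnP => d _ d_min sd; apply/eqP; rewrite eqn_leq; apply/andP; split.
  have [t /expression_chi_swaps tE st] := swaps_ex perm_chi_labels.
  rewrite sd -size_invs_chi_labels -st; apply: d_min.
  by apply/existsP; exists (in_tuple t).
have := @invs_swaps_le _ s (iota 0 (i + j)) (iota_uniq _ _) (size_iota _ _).
by rewrite sE size_invs_chi_labels invs_iota.
Qed.

End Chi.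

(** * Diagonal braidings *)

Section Diagonal.
Variables (K : fieldType) (V : vectType K) (N : nat) (e : N.-tuple V).
Hypothesis e_free : free e.
Variables (sigma : {linear Tsq K N -> Tsq K N}) (qq : 'I_N -> 'I_N -> K).
Hypothesis sigmaE : forall i j, sigma (tens2 e (tnth e i) (tnth e j)) =
                        qq i j *: tens2 e (tnth e j) (tnth e i).
Local Notation W := (seq 'I_N).
Implicit Types (u v w : W).

Lemma sigma_at_word x0 k w : (k.+1 < size w)%N ->
  sigma_at sigma k << w >> = qq (nth x0 w k) (nth x0 w k.+1) *: << swap k w >>.
Proof.
move=> lt_k.
have -> : swap k w = take k w ++ [:: nth x0 w k.+1, nth x0 w k & drop k.+2 w].
  have wE : w = take k w ++ [:: nth x0 w k, nth x0 w k.+1 & drop k.+2 w].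
    by rewrite -!drop_nth ?(ltnW lt_k) // cat_take_drop.
  by rewrite {1}wE -{1}(size_takel (ltnW (ltnW lt_k))) swap_cat.
rewrite /sigma_at /act_at lextU.
rewrite (drop_nth x0 (ltnW lt_k)) (drop_nth x0 lt_k).
rewrite -!(tens2_basis e_free) sigmaE !tens2_basis //.
by rewrite !linearZ /= !lextU.
Qed.

(** A sequence of adjacent transpositions with as many inversions as its
    length never undoes a swap, so each inversion contributes its factor. *)
Lemma Tsigma_swaps n (f : nat -> 'I_N) (s : seq 'I_n.-1) L :
  uniq L -> size L = n -> invs L = [::] -> size (invs (swaps s L)) = size s ->
  foldr (fun (k : 'I_n.-1) y => sigma_at sigma k y) << map f L >> s =
  (\prod_(p <- invs (swaps s L)) qq (f p.1) (f p.2)) *: << map f (swaps s L) >>.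
Proof.
move=> uL sL iL; elim: s => [|k s IH] /= Es.
  by rewrite iL big_nil scale1r.
set l := swaps s L in IH Es *.
have lt_k : (k.+1 < size l)%N by rewrite size_swaps sL adj_ltS.
have ul : uniq l by rewrite (perm_uniq (perm_swaps _ _)).
have le_l : (size (invs l) <= size s)%N.
  by have := invs_swaps_le s uL sL; rewrite iL.
have [lt_l|lt_l|/eqP] := ltngtP (nth 0%N l k) (nth 0%N l k.+1).
- have pl := invs_swap lt_k lt_l.
  rewrite IH; last by move: Es; rewrite (perm_size pl) => -[].
  rewrite (perm_big _ pl) big_cons /= [sigma_at _ _]/act_at linearZ /=.
  rewrite -[lext _ _]/(sigma_at sigma k _).
  rewrite (sigma_at_word (f 0%N)) ?size_map // map_swap scalerA mulrC.
  by rewrite !(nth_map 0%N) // ltnW.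
- by move: le_l; rewrite (perm_size (invs_swap_desc lt_k lt_l)) /= Es; lia.
by rewrite nth_uniq ?(ltnW lt_k) // eqn_leq ltnn andbF.
Qed.

Lemma Tsigma_chi (a : 'I_N) u v :
  Tsigma sigma (chi (size u) (size v)) << u ++ v >> = cross qq u v *: << v ++ u >>.
Proof.
set i := size u; set j := size v; pose f := nth a (u ++ v).
have fE : map f (iota 0 (i + j)) = u ++ v.
  by rewrite -size_cat map_nth_iota0 // take_size.
have uE : map f (iota 0 i) = u.
  by rewrite map_nth_iota0 ?take_size_cat // size_cat leq_addr.
have vE : map f (iota i j) = v.
  by rewrite map_nth_iota ?drop_size_cat ?size_cat ?addKn // take_size.
have := xchooseP (reduced_expression_ex (chi i j)).
rewrite /Tsigma -/(a_reduced_expression (chi i j)).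
move: (a_reduced_expression _) => s red.
have sE : swaps s (iota 0 (i + j)) = chi_labels i j.
  by apply/expression_chi_swaps; case/andP: red.
rewrite -fE (Tsigma_swaps f (iota_uniq _ _) (size_iota _ _) (invs_iota _ _)); last first.
  by rewrite sE size_invs_chi_labels (size_reduced_chi red).
rewrite sE map_cat uE vE; congr (_ *: _).
rewrite invs_cat_iota // big_allpairs_dep exchange_big /= /cross.
by rewrite -[in RHS]uE -[in RHS]vE big_map; apply: eq_bigr => x _; rewrite big_map.
Qed.

Lemma beta_wordE u v : beta_word sigma (u, v) = cross qq u v *: << (v, u) >>.
Proof.
rewrite /beta_word; case: u => [|a u]; first by rewrite cross0l scale1r.
case: v => [|b v]; first by rewrite cross0r scale1r.
rewrite (_ : (_ == _) || _ = false) // (Tsigma_chi a) [LHS]linearZ /= lextU /=.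
by rewrite (@take_size_cat _ (size v) v (a :: u) erefl)
  (@drop_size_cat _ (size v) v (a :: u) erefl).
Qed.

End Diagonal.

(** * The leading part of the product *)

Section LextFacts.
Variable K : fieldType.
Implicit Types A B C : choiceType.

Lemma lext_sum A (M : lmodType K) (f : A -> M) I (r : seq I) (P : pred I)
    (F : I -> {malg K[A]}) :
  lext f (\sum_(i <- r | P i) F i) = \sum_(i <- r | P i) lext f (F i).
Proof. exact: linear_sum. Qed.

Lemma lextZ A (M : lmodType K) (f : A -> M) c x : lext f (c *: x) = c *: lext f x.
Proof. exact: linearZ. Qed.

Lemma lext_lext A B (M : lmodType K) (f : B -> M) (g : A -> {malg K[B]}) x :
  lext f (lext g x) = lext (fun a => lext f (g a)) x.
Proof.
by rewrite {2}/lext linear_sum; apply: eq_bigr => a _; rewrite linearZ.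
Qed.

Lemma eq_lext_supp A (M : lmodType K) (P : A -> Prop) (f g : A -> M) x :
  supp_in P x -> (forall a, P a -> f a = g a) -> lext f x = lext g x.
Proof. by move=> hx h; apply: eq_big_seq => a /hx /h ->. Qed.

Lemma mcoeff_lext A B (f : A -> {malg K[B]}) x b :
  (lext f x)@_b = \sum_(a <- msupp x) x@_a * (f a)@_b.
Proof. by rewrite raddf_sum; apply: eq_bigr => a _; rewrite /= mcoeffZ. Qed.

Lemma mcoeff_basis A (a b : A) : (<< a >> : {malg K[A]})@_b = (a == b)%:R.
Proof. exact: mcoeffU. Qed.

Lemma mcoeff_lext_inj A B (g : A -> B) (x : {malg K[A]}) a : injective g ->
  (lext (fun a' => << g a' >> : {malg K[B]}) x)@_(g a) = x@_a.
Proof.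
move=> g_inj; rewrite (lextw _ (fsubsetUr [fset a]%fset (msupp x))) raddf_sum.
rewrite (big_fsetD1 a) ?in_fsetU ?in_fset1 ?eqxx //= mcoeffZ mcoeffUU mulr1.
rewrite big_seq big1 ?addr0 // => a'; rewrite in_fsetD1 => /andP[a'a _].
by rewrite mcoeffZ mcoeff_basis (inj_eq g_inj) (negPf a'a) mulr0.
Qed.

Lemma mcoeff_tmul A B (x : {malg K[A]}) (y : {malg K[B]}) a b :
  (tmul x y)@_(a, b) = x@_a * y@_b.
Proof.
have inner a' : (lext (fun b' => << (a', b') >> : {malg K[(A * B)%type]}) y)@_(a, b) = (a' == a)%:R * y@_b.
  case: eqP => [->|a'a]; first by rewrite mul1r mcoeff_lext_inj // => ? ? [].
  rewrite mul0r mcoeff_lext big1 // => b' _.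
  by rewrite mcoeff_basis xpair_eqE; case: eqP a'a => // _ _; rewrite mulr0.
rewrite mcoeff_lext.
under eq_bigr => a' _ do rewrite inner mulrA.
rewrite -mulr_suml; congr (_ * _).
have := congr1 (mcoeff a) (monalgE x); rewrite raddf_sum /= => ->.
by apply: eq_bigr => a' _; rewrite mcoeffU mulr_natr.
Qed.

End LextFacts.

Section TopCoef.
Variables (K : fieldType) (V : vectType K) (N : nat) (e : N.-tuple V).
Hypothesis e_free : free e.
Variables (sigma : {linear Tsq K N -> Tsq K N}) (qq : 'I_N -> 'I_N -> K).
Hypothesis sigmaE : forall i j, sigma (tens2 e (tnth e i) (tnth e j)) =
                        qq i j *: tens2 e (tnth e j) (tnth e i).
Variable m : V -> V -> V.
Local Notation W := (seq 'I_N).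
Implicit Types (u v w : W) (p : W * W) (x y : V).

Lemma mcoeff_tens_nil vs : (tens e vs)@_[::] = (vs == [::])%:R.
Proof.
case: vs => [|x vs] /=; first by rewrite mcoeffUU.
by rewrite mcoeff_lext big1 // => p _; rewrite mcoeff_basis mulr0.
Qed.

Lemma mcoeff_tens_cons vs x w c :
  (tens e (x :: vs))@_(c :: w) = (crd e x)@_c * (tens e vs)@_w.
Proof.
have g_inj : injective (fun p : 'I_N * W => p.1 :: p.2) by move=> [? ?] [? ?] [-> ->].
by rewrite /= (mcoeff_lext_inj _ (c, w) g_inj) mcoeff_tmul.
Qed.

Lemma mcoeff_tens_size vs w : size vs != size w -> (tens e vs)@_w = 0.
Proof.
elim: vs w => [|x vs IH] [|c w] // h.
- by rewrite mcoeff_basis.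
- by rewrite mcoeff_tens_nil.
by rewrite mcoeff_tens_cons IH ?mulr0.
Qed.

Lemma mcoeff_tens_rcons vs x w c :
  (tens e (rcons vs x))@_(rcons w c) = (tens e vs)@_w * (crd e x)@_c.
Proof.
elim: vs w => [|y vs IH] [|d w]; rewrite ?rcons_cons mcoeff_tens_cons ?IH.
- by rewrite /= !mcoeffUU mulrC.
- by rewrite !mcoeff_tens_size ?mulr0 ?mul0r //= size_rcons.
- by rewrite !mcoeff_tens_size ?mulr0 ?mul0r //= size_rcons.
by rewrite mcoeff_tens_cons mulrA.
Qed.

(** The iterated coproduct splits its first factor repeatedly; seen from the
    other end, it splits off the last factor once and iterates on the rest. *)
Lemma Delta_iterSr n p : Delta_iter sigma n.+1 p =
  lext (fun r => lext (fun s => << rcons s r.2 >>) (Delta_iter sigma n r.1))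
       (Delta_word sigma p).
Proof.
elim: n => [|n IH].
  by rewrite /= lextU; apply: eq_bigr => r _; rewrite lextU.
rewrite -[LHS]/(lext _ (Delta_iter sigma n.+1 p)) IH lext_lext; apply: eq_bigr => r _; congr (_ *: _).
rewrite /= !lext_lext.
apply: (eq_lext_supp (@Delta_iter_supp _ _ _ _ _)) => -[|a s] [] // _ _.
by rewrite lextU /= lext_lext; apply: eq_bigr => t _; rewrite lextU.
Qed.

(** Only the middle parts, the end of [u] and the beginning of [v], cross. *)
Lemma Delta_wordE u v : Delta_word sigma (u, v) =
  \sum_(i < (size u).+1) \sum_(j < (size v).+1)
    cross qq (drop i u) (take j v) *:
      << ((take i u, take j v), (drop i u, drop j v)) >>.
Proof.
rewrite /Delta_word /delta_word /tmul lext_lext lext_sum; apply: eq_bigr => i _.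
rewrite lextU lext_lext lext_sum; apply: eq_bigr => j _.
by rewrite !lextU /beta lextU (beta_wordE e_free sigmaE) lextZ lextU.
Qed.

Definition level n p : Talg K N := Mpow e m (Delta_iter sigma n p).

Lemma mcoeff_level_size n p w : size w != n.+1 -> (level n p)@_w = 0.
Proof.
move=> sw; rewrite /level /Mpow mcoeff_lext big_seq big1 // => s.
move=> /Delta_iter_supp [ss _].
by rewrite mcoeff_tens_size ?mulr0 // size_map ss eq_sym.
Qed.

Lemma mcoeff_levelS n u v w c : (level n.+1 (u, v))@_(rcons w c) =
  \sum_(i < (size u).+1) \sum_(j < (size v).+1)
    cross qq (drop i u) (take j v) * ((level n (take i u, take j v))@_w *
      (crd e (M_word e m (drop i u, drop j v)))@_c).
Proof.
have Mpow_rcons z b : (Mpow e m (lext (fun s => << rcons s b >>) z))@_(rcons w c) =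
    (Mpow e m z)@_w * (crd e (M_word e m b))@_c.
  rewrite /Mpow lext_lext !mcoeff_lext mulr_suml; apply: eq_bigr => s _.
  by rewrite lextU map_rcons mcoeff_tens_rcons mulrA.
rewrite /level Delta_iterSr Delta_wordE {1}/Mpow lext_lext lext_sum raddf_sum.
apply: eq_bigr => i _; rewrite lext_sum raddf_sum; apply: eq_bigr => j _.
by rewrite lextZ /= mcoeffZ lextU -/(Mpow e m _) Mpow_rcons.
Qed.

(** In top degree the last factor takes exactly one letter: without any letter
    [M] vanishes on it, and with more too few are left for the others.  This
    selects two terms of the double sum of mcoeff_levelS. *)
Lemma sum_corner (p q : nat) (F : nat -> nat -> K) :
  (forall i j, (i <= p)%N -> (j <= q)%N -> ((p - i) + (q - j) != 1)%N -> F i j = 0) ->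
  \sum_(i < p.+1) \sum_(j < q.+1) F i j =
  (if p is p'.+1 then F p' q else 0) + (if q is q'.+1 then F p q' else 0).
Proof.
move=> F0; rewrite big_ord_recr /=; congr (_ + _).
  case: p F0 => [|p] F0; first by rewrite big_ord0.
  rewrite big_ord_recr big1 /= => [|i _]; last first.
    by rewrite big1 // => j _; apply: F0; have := ltn_ord i; have := ltn_ord j; lia.
  rewrite add0r big_ord_recr big1 /= => [|j _]; first by rewrite add0r.
  by apply: F0; have := ltn_ord j; lia.
rewrite big_ord_recr /= [F p q]F0 ?addr0; [|lia..].
case: q F0 => [|q] F0; first by rewrite big_ord0.
rewrite big_ord_recr big1 /= => [|j _]; first by rewrite add0r.
by apply: F0; have := ltn_ord j; lia.
Qed.

(** In top degree each factor of [M] receives a single letter, so the product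
    [m] disappears and a quantum shuffle remains. *)
Lemma mcoeff_level_top n u v w : (size u + size v)%N = n.+1 -> size w = n.+1 ->
  (level n (u, v))@_w = shuffle_coef qq w u v.
Proof.
elim: n u v w => [|n IH] u v w suv; case/lastP: w => // w c; rewrite size_rcons => -[sw].
  rewrite (size0nil sw) /level /Mpow lextU.
  rewrite -[rcons _ _]/[:: c] -[map _ _]/[:: M_word e m (u, v)] mcoeff_tens_cons /= mcoeffUU mulr1.
  by case: u v suv => [|a [|a' u]] [|b [|b' v]] //= _;
    rewrite crd_basis // mcoeff_basis ?cross0l ?mulr1 ?addr0 ?add0r.
rewrite mcoeff_levelS (@sum_corner (size u) (size v)
  (fun i j => cross qq (drop i u) (take j v) * ((level n (take i u, take j v))@_w *
      (crd e (M_word e m (drop i u, drop j v)))@_c))); last first.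
  move=> i j le_i le_j d1; have [d0|d_gt1] : (size u - i + (size v - j) = 0)%N \/ 
      (1 < size u - i + (size v - j))%N by lia.
    have -> : drop i u = [::] by rewrite drop_oversize //; lia.
    have -> : drop j v = [::] by rewrite drop_oversize //; lia.
    by rewrite /= crd0 mcoeff0 !mulr0.
  rewrite /level (@Mpow_Delta_iter_eq0 _ _ _ e m sigma n.+1) ?mcoeff0 ?mul0r ?mulr0 //=.
  by rewrite !size_takel //; lia.
rewrite shuffle_coef_rcons; congr (_ + _).
  case: u suv => [//|a u] suv /=; rewrite [a :: u]lastI.
  rewrite -(size_belast a u) -cats1 take_size_cat // drop_size_cat // take_size drop_size.
  rewrite /= crd_basis // mcoeff_basis IH //; last by rewrite size_belast; move: suv => /=; lia.
  by rewrite mulrA mulrC mulrA.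
case: v suv => [//|b v] suv /=; rewrite [b :: v]lastI.
rewrite -(size_belast b v) -cats1 take_size_cat // drop_size_cat // take_size drop_size.
rewrite cross0l mul1r /= crd_basis // mcoeff_basis IH //.
  by rewrite mulrC.
by rewrite size_belast; move: suv => /=; lia.
Qed.

Lemma mcoeff_qqs_word u v w : v <> [::] ->
  (qqs_word e m sigma (u, v))@_w =
  \sum_(1 <= n < (size u + size v).+1) (level n.-1 (u, v))@_w.
Proof.
move=> v0; rewrite /qqs_word mcoeffD mcoeffZ raddf_sum /= /eps_word.
by case: v v0 => // b v _; rewrite mulr0 mul0r add0r.
Qed.

Lemma mcoeff_qqs_word_top u v w : v <> [::] ->
  size w = (size u + size v)%N ->
  (qqs_word e m sigma (u, v))@_w = shuffle_coef qq w u v.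
Proof.
case: v => // b v _; rewrite mcoeff_qqs_word //= addnS => sw.
rewrite big_nat_recr //= mcoeff_level_top //= ?addnS // big_nat big1 ?add0r // => n.
by move=> lt_n; apply: mcoeff_level_size; lia.
Qed.

Lemma mcoeff_qqs_word_out u v w : v <> [::] ->
  w = [::] \/ (size u + size v < size w)%N -> (qqs_word e m sigma (u, v))@_w = 0.
Proof.
move=> v0 hw; rewrite mcoeff_qqs_word //.
rewrite big_nat big1 // => n lt_n; apply: mcoeff_level_size.
by case: hw => [->|]; [case: n lt_n | lia].
Qed.

End TopCoef.

(** * Leading words *)

Section Leading.
Variables (K : fieldType) (N : nat).
Local Notation W := (seq 'I_N).
Implicit Types (u v w l : W) (x y : Talg K N).

Definition dle u v := (size u < size v)%N || ((size u == size v) && wle u v).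
Definition dlt u v := (size u < size v)%N || ((size u == size v) && wlt u v).

Lemma dle_refl u : dle u u.
Proof. by rewrite /dle eqxx wle_refl orbT. Qed.

Lemma dltW u v : dlt u v -> dle u v.
Proof. by case/orP=> [h|/andP[h /wltW k]]; rewrite /dle h ?k ?orbT. Qed.

Lemma dle_eqVlt u v : dle u v = (u == v) || dlt u v.
Proof.
rewrite /dle /dlt wle_eqVlt; case: (eqVneq u v) => [->|_]; last by [].
by rewrite eqxx orbT.
Qed.

Lemma dltNge u v : dlt u v = ~~ dle v u.
Proof. by rewrite /dle /dlt wltNge; case: ltngtP. Qed.

Lemma dle_trans v u w : dle u v -> dle v w -> dle u w.
Proof.
case/orP=> [uv|/andP[/eqP uv le_uv]]; case/orP=> [vw|/andP[/eqP vw le_vw]].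
- by rewrite /dle (ltn_trans uv vw).
- by rewrite /dle -vw uv.
- by rewrite /dle uv vw.
by rewrite /dle uv vw eqxx (wle_trans le_uv le_vw) orbT.
Qed.

Lemma dle_anti u v : dle u v -> dle v u -> u = v.
Proof. by rewrite dle_eqVlt => /predU1P[//|]; rewrite dltNge => /negPf ->. Qed.

Lemma dlt_ind (P : W -> Prop) :
  (forall w, (forall w', dlt w' w -> P w') -> P w) -> forall w, P w.
Proof.
(* The lexicographic order alone is not well founded; on the words of a given
   size it is, by induction on the first letter and then on the rest. *)
have lex n (Q : W -> Prop) :
    (forall w, size w = n ->
       (forall w', size w' = n -> wlt w' w -> Q w') -> Q w) ->
    forall w, size w = n -> Q w.
  elim: n Q => [|n IH] Q HQ.
    by move=> w sw; apply: HQ => // w' /size0nil ->; rewrite (size0nil sw) wltNge wle_refl.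
  suff hn d : forall a : 'I_N, (a < d)%N -> forall w, size w = n -> Q (a :: w).
    by case=> // a w [sw]; apply: (hn a.+1).
  elim: d => // d IHd a; rewrite ltnS leq_eqVlt => /predU1P[ad|]; last exact: IHd.
  apply: (IH (fun w => Q (a :: w))) => w sw IHw; apply: HQ => [|[//|a' w'] [sw']].
    by rewrite /= sw.
  rewrite wlt_cons => /orP[lt_a|/andP[/eqP -> /IHw]]; last exact.
  by apply: IHd; rewrite // -ad.
move=> H w; have [n] := ubnP (size w); elim: n w => // n IH w; rewrite ltnS.
rewrite leq_eqVlt => /predU1P[sw|]; last exact: IH.
apply: (lex n P) => // {sw}w sw hw; apply: H => w' /orP[lt_w|/andP[/eqP s' lt_w]].
  by apply: IH; rewrite -sw.
by apply: hw; rewrite // s'.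
Qed.

Definition leading x w := x@_w != 0 /\ forall w', x@_w' != 0 -> dle w' w.

Lemma leading_uniq x u v : leading x u -> leading x v -> u = v.
Proof. by move=> [xu umax] [xv vmax]; apply: dle_anti; [apply: vmax | apply: umax]. Qed.

Lemma leading_basis w : leading << w >> w.
Proof.
split=> [|w']; first by rewrite mcoeffUU oner_neq0.
by rewrite mcoeff_basis; case: (eqVneq w w') => [-> _|]; rewrite ?dle_refl // eqxx.
Qed.

Lemma lext_id x : x = \sum_(w <- msupp x) x@_w *: << w >>.
Proof.
apply/malgP => w; rewrite -[RHS]/((lext (fun w => << w >>) x)@_w).
by rewrite (@mcoeff_lext_inj _ _ _ id).
Qed.

Section Triangular.
Variable S : Talg K N -> Prop.

(** In a vanishing combination, the term with the largest leading word among
    those with a nonzero coefficient cannot be cancelled. *)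
Lemma leading_independent :
  (forall x, S x -> exists w, leading x w) ->
  (forall x y w, S x -> S y -> leading x w -> leading y w -> x = y) ->
  forall (s : seq (Talg K N)) (c : Talg K N -> K),
    uniq s -> (forall x, x \in s -> S x) ->
    \sum_(x <- s) c x *: x = 0 -> forall x, x \in s -> c x = 0.
Proof.
move=> exw inj s c us sS s0.
have max_lead (t : seq (Talg K N)) : (forall x, x \in t -> S x) -> t != [::] ->
    exists x w, [/\ x \in t, leading x w &
      forall y v, y \in t -> leading y v -> dle v w].
  elim: t => // x t IH tS _; have [w xw] := exw x (tS x (mem_head _ _)).
  have uniq_lead v : leading x v -> v = w by move/leading_uniq; apply.
  case: (eqVneq t [::]) => [->|t0].
    exists x, w; split; rewrite ?mem_head // => y v; rewrite inE => /eqP -> /uniq_lead ->.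
    exact: dle_refl.
  have [y|y [v [yt yv ymax]]] := IH _ t0; first by move=> yt; apply: tS; rewrite inE yt orbT.
  have [le_wv|] := boolP (dle w v).
    exists y, v; split; rewrite ?inE ?yt ?orbT // => z u /predU1P[->|]; last exact: ymax.
    by move/uniq_lead => ->.
  rewrite -dltNge => /dltW le_vw; exists x, w; split; rewrite ?mem_head // => z u.
  rewrite inE => /predU1P[-> /uniq_lead ->|zt zu]; first exact: dle_refl.
  exact: dle_trans (ymax z u zt zu) le_vw.
suff t0 : [seq x <- s | c x != 0] = [::].
  move=> x xs; apply/eqP; apply: contraTT isT => cx.
  have : x \in [seq x <- s | c x != 0] by rewrite mem_filter cx.
  by rewrite t0.
apply/eqP; apply: contraTT isT => t0.
have [x|x [w [+ xw xmax]]] := max_lead _ _ t0.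
  by rewrite mem_filter => /andP[_ /sS].
rewrite mem_filter => /andP[cx xs]; move: (congr1 (mcoeff w) s0).
rewrite raddf_sum mcoeff0 /= (bigD1_seq x) //= big_seq_cond big1 ?addr0.
  by rewrite mcoeffZ => /eqP; rewrite mulf_eq0 (negPf cx) (negPf xw.1).
move=> y /andP[ys yx]; rewrite mcoeffZ; have [->|cy] := eqVneq (c y) 0.
  by rewrite mul0r.
have [v yv] := exw y (sS y ys).
have [->|yw] := eqVneq y@_w 0; first by rewrite mulr0.
have vw : v = w.
  by apply: dle_anti; [apply: (xmax y); rewrite // mem_filter cy | apply: yv.2].
rewrite vw in yv; case/eqP: yx; exact: inj (sS y ys) (sS x xs) yv xw.
Qed.

(** Scalars attached to list entries rather than to vectors: repetitions are
    allowed, so sums are concatenations. *)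
Definition spanned y := exists r : seq (K * Talg K N),
  (forall p, p \in r -> S p.2) /\ y = \sum_(p <- r) p.1 *: p.2.

Lemma spanned0 : spanned 0.
Proof. by exists [::]; split=> //; rewrite big_nil. Qed.

Lemma spanned_gen x : S x -> spanned x.
Proof.
move=> xS; exists [:: (1, x)]; rewrite big_seq1 scale1r; split=> // p.
by rewrite inE => /eqP ->.
Qed.

Lemma spannedD x y : spanned x -> spanned y -> spanned (x + y).
Proof.
move=> [r [rS ->]] [t [tS ->]]; exists (r ++ t); rewrite big_cat; split=> // p.
by rewrite mem_cat => /orP[/rS|/tS].
Qed.

Lemma spannedZ c x : spanned x -> spanned (c *: x).
Proof.
move=> [r [rS ->]]; exists [seq (c * p.1, p.2) | p <- r]; split.
  by move=> p /mapP[p' /rS ? ->].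
by rewrite big_map scaler_sumr; apply: eq_bigr => p _; rewrite scalerA.
Qed.

Lemma spanned_sum (I : eqType) (r : seq I) (P : pred I) F :
  (forall i, i \in r -> P i -> spanned (F i)) -> spanned (\sum_(i <- r | P i) F i).
Proof.
elim: r => [|i r IH] h; first by rewrite big_nil; apply: spanned0.
have {}IH : spanned (\sum_(i <- r | P i) F i).
  by apply: IH => j jr; apply: h; rewrite inE jr orbT.
by rewrite big_cons; case: ifP => // Pi; apply: spannedD => //; apply: h; rewrite ?mem_head.
Qed.

Lemma spanned_combination y : spanned y -> exists (s : seq (Talg K N)) (c : Talg K N -> K),
  (forall x, x \in s -> S x) /\ y = \sum_(x <- s) c x *: x.
Proof.
move=> [r [rS ->]]; exists (undup (map snd r)), (fun x => \sum_(p <- r | p.2 == x) p.1).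
split=> [x|]; first by rewrite mem_undup => /mapP[p /rS ? ->].
under [RHS]eq_bigr => x _ do rewrite scaler_suml.
rewrite (exchange_big_dep predT) //= big_seq [RHS]big_seq; apply: eq_bigr => p pr.
under eq_bigl => x do rewrite eq_sym.
by rewrite -big_filter filter_pred1_uniq ?undup_uniq ?mem_undup ?map_f // big_seq1.
Qed.

Lemma leading_spanning : (forall x, S x -> x@_[::] = 0) ->
  (forall w, w <> [::] -> exists2 x, S x & leading x w) ->
  forall y, y@_[::] = 0 -> spanned y.
Proof.
move=> S0 exx.
suff span w : w <> [::] -> spanned << w >>.
  move=> y y0; rewrite (lext_id y); apply: spanned_sum => w wy _.
  by apply/spannedZ/span => w0; move: wy; rewrite w0 -mcoeff_neq0 y0 eqxx.
elim/dlt_ind: w => w IH w0; have [x xS [xw xmax]] := exx w w0.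
pose z := \sum_(v <- msupp x | v != w) x@_v *: << v >>.
have -> : << w >> = (x@_w)^-1 *: (x + (-1) *: z).
  rewrite {2}(lext_id x) (bigD1_seq w) ?fset_uniq //= -?mcoeff_neq0 //.
  by rewrite -/z scaleN1r addrK scalerA mulVf // scale1r.
apply/spannedZ/spannedD; first exact: spanned_gen.
apply/spannedZ/spanned_sum => v vx vw; apply/spannedZ/IH.
  by move: (xmax v); rewrite mcoeff_neq0 => /(_ vx); rewrite dle_eqVlt (negPf vw).
by move=> v0; move: vx; rewrite v0 -mcoeff_neq0 S0 ?eqxx.
Qed.

End Triangular.
End Leading.

Section QuantumInteger.
Variables (K : fieldType) (q : K).
Hypotheses (char0 : [pchar K] =i pred0) (q_neq0 : q != 0).
Hypothesis q_nroot : forall n : nat, (0 < n)%N -> q ^+ n != 1.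

(** A power of [q] is [1] or has infinite order; characteristic zero serves in
    the first case. *)
Lemma quantum_integer_neq0 (z : int) k : \sum_(i < k.+1) (q ^ z) ^+ i != 0.
Proof.
have [->|qz1] := eqVneq (q ^ z) 1.
  under eq_bigr do rewrite expr1n.
  by rewrite sumr_const card_ord ((pcharf0P K).1 char0).
apply/eqP => S0; have := subrX1 (q ^ z) k.+1; rewrite S0 mulr0 => /eqP.
rewrite subr_eq0; case: z qz1 {S0} => [[|n]|n] qz1; rewrite -?exprnP -?exprnN.
- by rewrite expr0z eqxx in qz1.
- by rewrite -exprM (negPf (q_nroot _)).
by rewrite exprVn invr_eq1 -exprM (negPf (q_nroot _)).
Qed.

End QuantumInteger.

(** * Lyndon products *)

Section LyndonProducts.
Variables (K : fieldType) (V : vectType K) (N : nat) (e : N.-tuple V).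
Hypothesis e_free : free e.
Variables (sigma : {linear Tsq K N -> Tsq K N}) (qq : 'I_N -> 'I_N -> K).
Hypothesis sigmaE : forall i j, sigma (tens2 e (tnth e i) (tnth e j)) =
                        qq i j *: tens2 e (tnth e j) (tnth e i).
Variable m : V -> V -> V.
Hypothesis cross_integer_neq0 : forall u v k,
  \sum_(i < k.+1) cross qq u v ^+ i != 0.
Local Notation W := (seq 'I_N).
Implicit Types (u v w l : W) (x y : Talg K N).

Lemma mcoeff_qqs_basis x l w :
  (qqs e m sigma x << l >>)@_w =
  \sum_(u <- msupp x) x@_u * (qqs_word e m sigma (u, l))@_w.
Proof.
rewrite /qqs /tmul lext_lext mcoeff_lext; apply: eq_bigr => u _.
by rewrite !lextU.
Qed.

(** A word [u] that is shorter than [U] gives only shorter words, and a smaller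
    one of the same length gives interleavings strictly below those of [U]. *)
Lemma qqs_word_dle U u l w : l <> [::] -> suffixes_ge l U -> dle u U ->
  (qqs_word e m sigma (u, l))@_w != 0 -> dle w (U ++ l) /\ (u != U -> w != U ++ l).
Proof.
move=> l0 hU le_uU qw.
have sw : (size w <= size u + size l)%N.
  rewrite leqNgt; apply: contraNN qw => lt_w.
  by rewrite (mcoeff_qqs_word_out _ _ _ l0 (or_intror lt_w)).
case/orP: le_uU => [lt_uU|/andP[/eqP sU le_uU]].
  have lt_w : (size w < size (U ++ l))%N by rewrite size_cat; lia.
  split=> [|_]; first by rewrite /dle lt_w.
  by apply: contraTneq lt_w => ->; rewrite ltnn.
case: (ltngtP (size w) (size u + size l)) sw => // [lt_w|sw] _.
  rewrite sU -size_cat in lt_w; split=> [|_]; first by rewrite /dle lt_w.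
  by apply: contraTneq lt_w => ->; rewrite ltnn.
rewrite (mcoeff_qqs_word_top e_free sigmaE m l0 sw) in qw.
have h := shuffle_coef_interleaving qw.
move: le_uU; rewrite wle_eqVlt => /predU1P[uU|lt_uU].
  rewrite uU eqxx /dle size_cat sw sU eqxx; split=> //; apply/orP; right.
  by apply: interleaving_le hU _; rewrite -uU.
have [w' h' lt_w] := interleaving_lt sU lt_uU h.
have {h'}lt_w := wlt_le_trans lt_w (interleaving_le hU h').
rewrite /dle size_cat sw sU eqxx (wltW lt_w) orbT; split=> // _.
by apply: contraTneq lt_w => ->; rewrite wltNge wle_refl.
Qed.

Lemma leading_qqs x U l : leading x U -> lyndon l -> suffixes_ge l U ->
  leading (qqs e m sigma x << l >>) (U ++ l).
Proof.
move=> [xU xmax] llyn hU; have [l0 _] := llyn.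
split=> [|w]; rewrite mcoeff_qqs_basis; last first.
  apply: contraNT => nle_w; rewrite big_seq big1 // => u ux.
  apply/eqP; rewrite mulf_eq0; apply/orP; right; apply: contraNT nle_w => qw.
  have le_u : dle u U by apply: xmax; rewrite mcoeff_neq0.
  by have [] := qqs_word_dle l0 hU le_u qw.
rewrite (bigD1_seq U) ?fset_uniq ?mcoeff_neq0 //= -?mcoeff_neq0 //.
rewrite big_seq_cond big1 ?addr0 => [|u /andP[ux uU]]; last first.
  apply/eqP; rewrite mulf_eq0; apply/orP; right; apply: contraTT isT => qw.
  have le_u : dle u U by apply: xmax; rewrite mcoeff_neq0.
  by have [_ /(_ uU)] := qqs_word_dle l0 hU le_u qw; rewrite eqxx.
rewrite mulf_neq0 // (mcoeff_qqs_word_top e_free sigmaE) ?size_cat //.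
by have [k [_ _ ->]] := shuffle_coef_max qq llyn hU; apply: cross_integer_neq0.
Qed.

Lemma leading_lyndon_product l ls : (forall w, w \in l :: ls -> lyndon w) ->
  nonincreasing (l :: ls) ->
  let x := foldl (fun y w => qqs e m sigma y << w >>) << l >> ls in
  leading x (flatten (l :: ls)) /\ x@_[::] = 0.
Proof.
elim/last_ind: ls => [|ls k IH] lyn srt.
  split; first by rewrite /= cats0; apply: leading_basis.
  rewrite /= mcoeff_basis; case: eqP => // l0.
  by have [] := lyn l (mem_head _ _).
have klyn : lyndon k by apply: lyn; rewrite -rcons_cons mem_rcons mem_head.
have lyn' w : w \in l :: ls -> lyndon w.
  by move=> wls; apply: lyn; rewrite -rcons_cons mem_rcons inE wls orbT.
rewrite foldl_rcons -rcons_cons flatten_rcons; rewrite -rcons_cons in srt.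
have [|lead _] := IH lyn'.
  by move: srt; rewrite /nonincreasing -cats1 => /cat_sorted2[].
split.
  apply: leading_qqs lead klyn _; apply: suffixes_ge_flatten => w wls.
  by split; [apply: lyn' | apply: (nonincreasing_rcons srt)].
rewrite mcoeff_qqs_basis big1 // => u _.
rewrite mcoeff_qqs_word_out ?mulr0 //; [by case: klyn | by left].
Qed.

Lemma lyndon_products_basis : is_linear_basis (lyndon_product e m sigma) (@Tplus K N).
Proof.
have x0 x : lyndon_product e m sigma x -> x@_[::] = 0.
  by move=> [l [ls [lyn srt ->]]]; case: (leading_lyndon_product lyn srt).
split; first exact: x0.
  apply: leading_independent => [x|x y w] [l [ls [lyn srt ->]]].
    by exists (flatten (l :: ls)); case: (leading_lyndon_product lyn srt).
  move=> [l' [ls' [lyn' srt' ->]]] xw yw.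
  have [lead _] := leading_lyndon_product lyn srt.
  have [lead' _] := leading_lyndon_product lyn' srt'.
  have E : flatten (l :: ls) = flatten (l' :: ls').
    by rewrite (leading_uniq lead xw) (leading_uniq lead' yw).
  by have [-> ->] := lyndon_factorization_uniq lyn lyn' srt srt' E.
move=> y y0; apply: spanned_combination; apply: leading_spanning y0 => // w w0.
have [[|l ls] [wE lyn srt]] := lyndon_factorization w; first by case: w0; rewrite -wE.
have [lead _] := leading_lyndon_product lyn srt.
by rewrite -wE; exists (foldl (fun y w => qqs e m sigma y << w >>) << l >> ls);
  first by exists l, ls.
Qed.

End LyndonProducts.

Theorem proposition17 (K : fieldType) (char0 : [pchar K] =i pred0)
  (V : vectType K) (N : nat) (e : N.-tuple V) (e_basis : basis_of fullv e)
  (m : {bilinear V -> V -> V}) (one : V)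
  (sigma : {linear Tsq K N -> Tsq K N})
  (YB : YB_algebra e m sigma one)
  (q : K) (q_neq0 : q != 0) (q_nroot : forall n : nat, (0 < n)%N -> q ^+ n != 1)
  (qq : 'I_N -> 'I_N -> K)
  (qq_pow : forall i j, exists n : int, qq i j = q ^ n)
  (sigmaE : forall i j, sigma (tens2 e (tnth e i) (tnth e j)) =
                        qq i j *: tens2 e (tnth e j) (tnth e i)) :
  is_linear_basis (lyndon_product e m sigma) (@Tplus K N).
Proof.
apply: (lyndon_products_basis (basis_free e_basis) sigmaE) => u v k.
have powM (x y : K) : (exists z : int, x = q ^ z) -> (exists z : int, y = q ^ z) ->
    exists z : int, x * y = q ^ z.
  by move=> [a ->] [b ->]; exists (a + b); rewrite expfzDr.
have [z ->] : exists z : int, cross qq u v = q ^ z.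
  have pow1 : exists z : int, 1 = q ^ z by exists 0; rewrite expr0z.
  by apply: (big_ind (fun x => exists z : int, x = q ^ z)) => // a _;
    apply: (big_ind (fun x => exists z : int, x = q ^ z)).
exact: quantum_integer_neq0.
Qed.
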